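(* Let $\mathcal H$ be a complex Hilbert space of (finite or infinite) dimension at least $2$, let $2\le k\le\dim\mathcal H$ be an integer, and let $c=(c_1,\dots,c_k)\in\mathbb R^k$ with $c_1\ge\dots\ge c_k$ and not all $c_i$ equal. Let $\Phi:\mathfrak B(\mathcal H)\to\mathfrak B(\mathcal H)$ be a surjective map preserving weak zero products on both sides. Then $W_c(\Phi(A)\Phi(B))=W_c(AB)$ for all $A,B\in\mathfrak B(\mathcal H)$ if and only if $\Phi$ has one of the following forms: (i) When $c_1+c_k\neq 0$: there are a unitary operator $U\in\mathfrak B(\mathcal H)$ and a sign $\varepsilon\in\{1,-1\}$ such that $\Phi(A)=\varepsilon UAU^*$ for all $A\in\mathfrak B(\mathcal H)$. (ii) When there exists an integer $p$ with $1<p<k$ such that $c_p+c_{k+1-p}\neq 0$ and $c_j+c_{k+1-j}=0$ for $j=1,\dots,p-1$: there are a unitary operator $U\in\mathfrak B(\mathcal H)$ and functions $\phi:\mathcal T\to\{-1,1\}$ and $\phi':\mathfrak B(\mathcal H)\to\{-1,1\}$ satisfying $\phi'(A)\phi'(B)\in\mathrm{sgn}(AB)$ for all $A,B\in\mathfrak B(\mathcal H)$, such that $$\Phi(A)=\begin{cases}\phi(A)\,UAU^* & \text{if } A\in\mathcal T,\\ \phi'(A)\,UAU^* & \text{if } A\in\mathcal S\setminus\mathcal T,\\ \pm UAU^* & \text{if } A\in\mathfrak B(\mathcal H)\setminus\mathcal S,\end{cases}$$ for all $A\in\mathfrak B(\mathcal H)$, where the sign $\pm$ in the last line is one fixed sign,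 the same for all $A\in\mathfrak B(\mathcal H)\setminus\mathcal S$. (iii) When $c_j+c_{k+1-j}=0$ for $j=1,\dots,k$: there are a unitary operator $U\in\mathfrak B(\mathcal H)$ and a function $g:\mathfrak B(\mathcal H)\to\{1,-1\}$ such that either $\Phi(A)=g(A)UAU^*$ for all $A\in\mathfrak B(\mathcal H)$, or $\Phi(A)=i\,g(A)UAU^*$ for all $A\in\mathfrak B(\mathcal H)$.
   Context: $\mathfrak B(\mathcal H)$ is the algebra of all bounded linear operators on $\mathcal H$. For $c=(c_1,\dots,c_k)\in\mathbb R^k$ with $k\le\dim\mathcal H$, the $c$-numerical range of $A\in\mathfrak B(\mathcal H)$ is $W_c(A)=\{\sum_{j=1}^k c_j\langle Ae_j,e_j\rangle:\{e_1,\dots,e_k\}\text{ an orthonormal subset of }\mathcal H\}$. Let $\mathcal S=\{A\in\mathfrak B(\mathcal H): W_c(A)=-W_c(A)\}$ (operators with symmetric $c$-numerical range) and $\mathcal T=\{A\in\mathcal S: AB\in\mathcal S\text{ and }BA\in\mathcal S\text{ for every }B\in\mathfrak B(\mathcal H)\}$. For an operator $C$, $\mathrm{sgn}(C)$ denotes the set $\{1\}$ if $C\notin\mathcal S$ and the set $\{-1,1\}$ if $C\in\mathcal S$. A map $\Phi:\mathfrak B(\mathcal H)\to\mathfrak B(\mathcal H)$ preserves weak zero products if for every $A\in\mathfrak B(\mathcal H)$ and every rank-one $T\in\mathfrak B(\mathcal H)$, $AT=0$ implies $\Phi(A)\Phi(T)=0$. It preserves weak zero products on both sides if it preserves weak zero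 products and, in addition, for every $B\in\mathfrak B(\mathcal H)$ and every rank-one $S\in\mathfrak B(\mathcal H)$, $BS=0$ implies $\tilde B\tilde S=0$, where $\Phi(\tilde B)=B$ and $\Phi(\tilde S)=S$.
   Formalization: In form (ii) the fixed sign used for A outside S is required to equal the (constant) value of φ' there; with a sign independent of φ' the ''if'' part fails, e.g. for c=(1,1,-1) on C^3. *)

(* Defs.v *)
From HB Require Import structures.
From mathcomp Require Import all_boot all_order all_algebra.
From mathcomp Require Import sesquilinear complex.
From mathcomp Require Import all_classical all_reals.
From mathcomp Require Import topology normedtype.

Set Implicit Arguments.
Unset Strict Implicit.
Unset Printing Implicit Defensive.

Import Order.TTheory GRing.Theory Num.Theory.
Import numFieldNormedType.Exports.

Local Open Scope classical_set_scope.
Local Open Scope complex_scope.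
Local Open Scope ring_scope.

Section BoundedOperators.
Context {R : realType} (H : normedModType R[i]).

Record bop := BOp {
  bop_fun :> H -> H ;
  bop_linear : linear bop_fun ;
  bop_bounded : exists M : R, forall x, `|bop_fun x| <= M%:C * `|x| }.

HB.instance Definition _ := gen_eqMixin bop.
HB.instance Definition _ := gen_choiceMixin bop.

HB.instance Definition _ (A : bop) :=
  GRing.isLinear.Build R[i] H H *:%R (bop_fun A) (bop_linear A).

Lemma bop_ext (A B : bop) : A =1 B -> A = B.
Proof.
case: A B => [f lf bf] [g lg bg] /= /funext eq_fg.
case: _ / eq_fg lg bg => lg bg.
by rewrite (Prop_irrelevance lf lg) (Prop_irrelevance bf bg).
Qed.

Lemma bop_bounded_ge0 (A : bop) :
  exists2 M : R[i], 0 <= M & forall x, `|A x| <= M * `|x|.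
Proof.
have [M AM] := bop_bounded A; exists `|M%:C| => // x.
by apply: le_trans (AM x) _; rewrite ler_wpM2r// real_ler_norm// complex_real.
Qed.

Lemma complex_bound (f : H -> H) (M : R[i]) : 0 <= M ->
  (forall x, `|f x| <= M * `|x|) ->
  exists M : R, forall x, `|f x| <= M%:C * `|x|.
Proof. by move=> /ger0_real/RRe_real <- fM; exists (complex.Re M). Qed.

Fact bop0_linear : linear (fun _ : H => 0 : H).
Proof. by move=> a x y; rewrite scaler0 addr0. Qed.
Fact bop0_bounded : exists M : R, forall x : H, `|0 : H| <= M%:C * `|x|.
Proof. by exists 0 => x; rewrite normr0 mul0r. Qed.
Definition bop0 : bop := BOp bop0_linear bop0_bounded.

Fact bop1_linear : linear (fun x : H => x).
Proof. by []. Qed.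
Fact bop1_bounded : exists M : R, forall x : H, `|x| <= M%:C * `|x|.
Proof. by exists 1 => x; rewrite mul1r. Qed.
Definition bop1 : bop := BOp bop1_linear bop1_bounded.

Fact bopM_linear (A B : bop) : linear (fun x => A (B x)).
Proof. by move=> a x y; rewrite !linearP. Qed.
Fact bopM_bounded (A B : bop) :
  exists M : R, forall x, `|A (B x)| <= M%:C * `|x|.
Proof.
have [M M0 AM] := bop_bounded_ge0 A; have [N N0 BN] := bop_bounded_ge0 B.
apply: (@complex_bound _ (M * N)) => [|x]; first exact: mulr_ge0.
by apply: le_trans (AM _) _; rewrite -mulrA ler_wpM2l.
Qed.
Definition bopM (A B : bop) : bop := BOp (bopM_linear A B) (bopM_bounded A B).

Fact bopZ_linear (a : R[i]) (A : bop) : linear (fun x => a *: A x).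
Proof. by move=> b x y; rewrite linearP scalerDr !scalerA mulrC. Qed.
Fact bopZ_bounded (a : R[i]) (A : bop) :
  exists M : R, forall x, `|a *: A x| <= M%:C * `|x|.
Proof.
have [M M0 AM] := bop_bounded_ge0 A.
apply: (@complex_bound _ (`|a| * M)) => [|x]; first exact: mulr_ge0.
by rewrite normrZ -mulrA ler_wpM2l.
Qed.
Definition bopZ (a : R[i]) (A : bop) : bop :=
  BOp (bopZ_linear a A) (bopZ_bounded a A).

Definition rank_one (A : bop) :=
  exists2 v : H, v != 0 & range A = [set a *: v | a in [set: R[i]]].

Definition preserves_weak_zero_products (Phi : bop -> bop) :=
  forall A T : bop, rank_one T -> bopM A T = bop0 ->
    bopM (Phi A) (Phi T) = bop0.

(* [B'] and [S'] range over all preimages of [B] and [S]. *)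
Definition preserves_weak_zero_products_both_sides (Phi : bop -> bop) :=
  preserves_weak_zero_products Phi /\
  forall B S B' S' : bop, rank_one S -> bopM B S = bop0 ->
    Phi B' = B -> Phi S' = S -> bopM B' S' = bop0.

End BoundedOperators.

Arguments bop0 {R H}.
Arguments bop1 {R H}.

(* The pair ([H], [dot]) is a Hilbert space when [H] is complete and
   [dot_induces_norm dot] holds; [dot] is linear in its first argument and
   conjugate linear in the second one. *)
Section HilbertSpace.
Context {R : realType} {H : normedModType R[i]}.
Variable dot : {dot H for (@Num.conj R[i])}.

Definition dot_induces_norm := forall x : H, `|x| ^+ 2 = dot x x.

Definition orthonormal_set (E : set H) :=
  (forall x, E x -> dot x x = 1) /\
  (forall x y, E x -> E y -> x != y -> dot x y = 0).

Definition orthonormal_basis (E : set H) :=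
  orthonormal_set E /\
  forall F : set H, orthonormal_set F -> E `<=` F -> F = E.

Definition hilbert_dim_ge (n : nat) :=
  exists2 E : set H, orthonormal_basis E & (`I_n #<= E)%card.

Definition is_adjoint (A B : bop H) := forall x y, dot (A x) y = dot x (B y).

(* The default value [bop0] is never used on a Hilbert space, where the Riesz
   representation theorem provides the adjoint. *)
Definition adjoint (A : bop H) : bop H := xget bop0 [set B | is_adjoint A B].

Lemma adjointE (A B : bop H) : is_adjoint A B -> adjoint A = B.
Proof.
move=> AB; apply: xget_unique => // C AC; apply: bop_ext => y.
apply/eqP; rewrite -subr_eq0; apply/negPn/negP => neq.
have := neq0_dnorm_gt0 (s := dot) _ neq; rewrite linearBr/=.
by rewrite -AC -AB subrr ltxx.
Qed.

Definition unitary (U : bop H) :=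
  bopM (adjoint U) U = bop1 /\ bopM U (adjoint U) = bop1.

Definition conj_by (U A : bop H) : bop H := bopM (bopM U A) (adjoint U).

Section NumericalRange.
Variables (k : nat) (c : k.-tuple R).

Definition c_numerical_range (A : bop H) : set R[i] :=
  [set z | exists2 e : k.-tuple H, orthonormal dot e &
     z = \sum_(j < k) (tnth c j)%:C * dot (A (tnth e j)) (tnth e j)].

Definition symmetric_range (A : bop H) :=
  c_numerical_range A = [set - z | z in c_numerical_range A].

Definition symmetric_core (A : bop H) :=
  symmetric_range A /\
  forall B, symmetric_range (bopM A B) /\ symmetric_range (bopM B A).

Definition sgn_set (C : bop H) : set R[i] :=
  [set s | s = 1 \/ (s = - 1 /\ symmetric_range C)].

End NumericalRange.
End HilbertSpace.

(* [c_j + c_(k+1-j)] with the indices [j = 1, ..., k] counted from 1. *)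
Definition pair_sum {R : realType} {k : nat} (c : k.-tuple R) (j : nat) : R :=
  c`_j.-1 + c`_(k - j).

Section Forms.
Context {R : realType} {H : normedModType R[i]}.
Variable dot : {dot H for (@Num.conj R[i])}.

Definition is_sign (s : R[i]) := s = 1 \/ s = - 1.

Definition form_i (Phi : bop H -> bop H) :=
  exists U eps, [/\ unitary dot U, is_sign eps &
    forall A, Phi A = bopZ eps (conj_by dot U A)].

(* [phi] only matters on [symmetric_core dot c].  The condition on the products
   [phi' A * phi' B] forces [phi' A = phi' bop1] for every [A] whose range is
   not symmetric; the fixed sign [eps] used for those [A] is this common value.
   It cannot be chosen independently of [phi']: for c = (1, 1, -1) and
   H = C^3, taking [U], [phi] and [phi'] trivial and [eps] = -1 gives a map
   with W_c (Phi A Phi B) <> W_c (A B) for A = diag (1, 0, -1) and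
   B = diag (1, 1, -1). *)
Definition form_ii (k : nat) (c : k.-tuple R) (Phi : bop H -> bop H) :=
  let S := symmetric_range dot c in
  let T := symmetric_core dot c in
  exists (U : bop H) (phi phi' : bop H -> R[i]) (eps : R[i]),
    [/\ unitary dot U,
        forall A, T A -> is_sign (phi A),
        forall A, is_sign (phi' A),
        forall A B, sgn_set dot c (bopM A B) (phi' A * phi' B) &
        [/\ is_sign eps,
            forall A, ~ S A -> phi' A = eps,
            forall A, T A -> Phi A = bopZ (phi A) (conj_by dot U A),
            forall A, S A -> ~ T A -> Phi A = bopZ (phi' A) (conj_by dot U A) &
            forall A, ~ S A -> Phi A = bopZ eps (conj_by dot U A)]].

Definition form_iii (Phi : bop H -> bop H) :=
  exists (U : bop H) (g : bop H -> R[i]),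
    [/\ unitary dot U, forall A, is_sign (g A) &
      (forall A, Phi A = bopZ (g A) (conj_by dot U A)) \/
      (forall A, Phi A = bopZ ('i * g A) (conj_by dot U A))].

End Forms.

(* Main.v *)
Require Import Defs.
From mathcomp Require Import all_boot all_order all_algebra.
From mathcomp Require Import sesquilinear complex.
From mathcomp Require Import all_classical all_reals.
From mathcomp Require Import topology normedtype.
From mathcomp Require Import zify ring lra.

(** Write [x (x) y] for the operator [z |-> <z, y> x].

    That each of the three forms preserves the range of products is a direct
    computation.  Conjugation by [U] permutes orthonormal families, and every
    sign that occurs in a product either is 1 or meets a symmetric range.
    When [c_j + c_(k+1-j) = 0] for all [j], reversing the family shows that
    every range is symmetric.

    For the converse, the information is carried by operators of rank one.
    The form [e |-> sum_i c_i <v, e_i> <e_i, v>] takes values between [m |v|^2]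
    and [M |v|^2], and the two bounds are reached simultaneously on any pair of
    orthogonal vectors ([weight_extrema]).  As the real part of [x (x) y] is a
    difference of squares of orthogonal vectors once [<x, y>] is real, this
    gives the support function of the elliptical disc [W_c(x (x) y)]
    ([pair_value_support]).  Its width in every direction determines
    [<x, y>^2] and [|x| |y|], and its centre determines [<x, y>] itself when
    [c_1 + c_k <> 0] ([pair_range_inj]).

    The zero product conditions force [Phi] to exchange operators of rank one
    with operators of rank one ([Phi_rank1], [Phi_rank1_preimage]).  So
    [W_c(Phi A Phi T) = W_c(A T)] for [T] of rank one means that
    [tr(Phi A Phi T)^2 = tr(A T)^2] and that the norms of the products agree.
    For a unit vector [e0], the operators [x (x) e0] are sent to
    [f x (x) u0] with [<f x, f y>^2 = <x, y>^2].  The only freedom left is a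
    sign, not a phase, and it can be removed: such an [f] is a linear isometry
    up to signs ([signed_isometry]).  This is a form of Wigner's theorem in
    which the antiunitary case cannot occur.  It yields a unitary [U] with
    [Phi (x (x) y) = a (U x (x) U y)], where [a^2] is a constant equal to 1 or
    to -1, and then the trace identity for arbitrary [A] gives
    [Phi A = +- eta U A U^*] with [eta] one of 1 and [i]
    ([Phi_unitary_form]).

    The three cases differ in how much of the ambiguity survives.  If
    [c_1 + c_k <> 0], traces are preserved exactly, so [eta = 1] and the sign
    is constant.  If [c] is antisymmetric, nothing more can be said.
    Otherwise [eta = i] would make [W_c(A^2)] symmetric for all [A], which
    fails for a projection of rank [p] ([asymmetric_projection]); so
    [eta = 1], and [W_c(Phi A Phi B) = W_c(A B)] is exactly the condition on the
    products of signs. *)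

Set Implicit Arguments.
Unset Strict Implicit.
Unset Printing Implicit Defensive.

Import Order.TTheory GRing.Theory Num.Theory.
Import numFieldNormedType.Exports.

Local Open Scope classical_set_scope.
Local Open Scope complex_scope.
Local Open Scope ring_scope.

(** * Real and imaginary parts *)

Section ComplexParts.
Context {R : realType}.
Implicit Types x y z : R[i].
Local Notation Re := complex.Re.
Local Notation Im := complex.Im.

Lemma ReD x y : Re (x + y) = Re x + Re y. Proof. by case: x y => [? ?] [? ?]. Qed.
Lemma ImD x y : Im (x + y) = Im x + Im y. Proof. by case: x y => [? ?] [? ?]. Qed.
Lemma ReN x : Re (- x) = - Re x. Proof. by case: x. Qed.
Lemma ImN x : Im (- x) = - Im x. Proof. by case: x. Qed.
Lemma ReM x y : Re (x * y) = Re x * Re y - Im x * Im y.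
Proof. by case: x y => [? ?] [? ?]. Qed.
Lemma ImM x y : Im (x * y) = Re x * Im y + Im x * Re y.
Proof. by case: x y => [? ?] [? ?]. Qed.
Lemma ReJ x : Re x^* = Re x. Proof. by case: x. Qed.
Lemma ImJ x : Im x^* = - Im x. Proof. by case: x. Qed.
Lemma Re_sum I (r : seq I) (P : pred I) (F : I -> R[i]) :
  Re (\sum_(i <- r | P i) F i) = \sum_(i <- r | P i) Re (F i).
Proof. by apply: (big_morph _ ReD). Qed.

Definition partE := (ReD, ImD, ReN, ImN, ReM, ImM, ReJ, ImJ).

Lemma complex_ext x y : Re x = Re y -> Im x = Im y -> x = y.
Proof. by case: x y => [? ?] [? ?] /= -> ->. Qed.

(** The modulus of [R[i]] has complex values, in a partial order; the
    inequalities below are between squared moduli in the ordered field [R]. *)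
Definition abs2 z : R := Re z ^+ 2 + Im z ^+ 2.

Lemma abs2_ge0 z : 0 <= abs2 z. Proof. by rewrite addr_ge0 ?sqr_ge0. Qed.
Lemma abs2M z w : abs2 (z * w) = abs2 z * abs2 w.
Proof. rewrite /abs2 !partE; ring. Qed.
Lemma abs2J z : abs2 z^* = abs2 z.
Proof. by rewrite /abs2 !partE sqrrN. Qed.
Lemma abs2E z : (abs2 z)%:C = z * z^*.
Proof. apply: complex_ext; rewrite /abs2 !partE /=; ring. Qed.
Lemma abs2_eq0 z : (abs2 z == 0) = (z == 0).
Proof.
rewrite -(inj_eq (@complexI _)) abs2E mulf_eq0 conjC_eq0.
by rewrite orbb.
Qed.
Lemma abs2_sqr z w : z ^+ 2 = w ^+ 2 -> abs2 z = abs2 w.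
Proof.
move=> e; have := congr1 abs2 e; rewrite !expr2 !abs2M -!expr2.
by move/(pexpIrn (n := 2)) => -> //; rewrite ?nnegrE ?abs2_ge0.
Qed.
Lemma abs2_realC (t : R) : abs2 (t%:C : R[i]) = t ^+ 2.
Proof. by rewrite /abs2 /= expr0n addr0. Qed.

End ComplexParts.

(** * Inner products with real-valued squared norms *)

Section InnerProduct.
Context {R : realType} {H : normedModType R[i]}.
Variable dot : {dot H for (@Num.conj R[i])}.
Implicit Types (x y z : H) (a b : R[i]) (t : R).
Local Notation Re := complex.Re.
Local Notation Im := complex.Im.

Lemma dotC x y : dot x y = (dot y x)^*.
Proof. by rewrite hermC /= expr0 mul1r. Qed.
Lemma dotDl x y z : dot (x + y) z = dot x z + dot y z.
Proof. exact: linearDl. Qed.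
Lemma dotDr x y z : dot z (x + y) = dot z x + dot z y.
Proof. exact: linearDr. Qed.
Lemma dotBl x y z : dot (x - y) z = dot x z - dot y z.
Proof. exact: linearBl. Qed.
Lemma dotBr x y z : dot z (x - y) = dot z x - dot z y.
Proof. exact: linearBr. Qed.
Lemma dotNl x y : dot (- x) y = - dot x y.
Proof. exact: linearNl. Qed.
Lemma dotNr x y : dot x (- y) = - dot x y.
Proof. exact: linearNr. Qed.
Lemma dotZl a x y : dot (a *: x) y = a * dot x y.
Proof. exact: linearZl_LR. Qed.
Lemma dotZr a x y : dot x (a *: y) = a^* * dot x y.
Proof. exact: linearZr_LR. Qed.
Lemma dot0l x : dot 0 x = 0. Proof. exact: linear0l. Qed.
Lemma dot0r x : dot x 0 = 0. Proof. exact: linear0r. Qed.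
Lemma dot_suml I (r : seq I) (P : pred I) (F : I -> H) x :
  dot (\sum_(i <- r | P i) F i) x = \sum_(i <- r | P i) dot (F i) x.
Proof. by apply: (big_morph (dot^~ x)) => [y z|]; rewrite ?dotDl ?dot0l. Qed.
Lemma dot_sumr I (r : seq I) (P : pred I) (F : I -> H) x :
  dot x (\sum_(i <- r | P i) F i) = \sum_(i <- r | P i) dot x (F i).
Proof. by apply: (big_morph (dot x)) => [y z|]; rewrite ?dotDr ?dot0r. Qed.

Definition dotE := (dotDl, dotDr, dotBl, dotBr, dotNl, dotNr, dotZl, dotZr).

(** Kept in [R] for the same reason as [abs2]. *)
Definition sqnorm x : R := Re (dot x x).
Local Notation sq := sqnorm.

Lemma Im_dotxx x : Im (dot x x) = 0.
Proof.
have := congr1 (@complex.Im _) (dotC x x); rewrite ImJ => /eqP.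
by rewrite -subr_eq0 opprK -mulr2n mulrn_eq0 /= => /eqP.
Qed.

Lemma dotxx x : dot x x = (sq x)%:C.
Proof. by apply: complex_ext; rewrite ?Im_dotxx. Qed.

Lemma sq_gt0 x : x != 0 -> 0 < sq x.
Proof.
by move/(neq0_dnorm_gt0 (s := dot)); rewrite dotxx -[0]/(0%:C) ltcR.
Qed.

Lemma sq0 : sq 0 = 0. Proof. by rewrite /sqnorm dot0l. Qed.

Lemma sq_ge0 x : 0 <= sq x.
Proof. by have [->|/sq_gt0/ltW//] := eqVneq x 0; rewrite sq0. Qed.

Lemma sq_eq0 x : (sq x == 0) = (x == 0).
Proof.
by have [->|/sq_gt0/gt_eqF//] := eqVneq x 0; rewrite sq0 eqxx.
Qed.

Lemma dotxx_eq0 x : (dot x x == 0) = (x == 0).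
Proof. by rewrite dotxx -[0 in LHS]/(0%:C) (inj_eq (@complexI _)) sq_eq0. Qed.

Lemma dot_eq0C x y : dot x y = 0 -> dot y x = 0.
Proof. by rewrite (dotC y x) => ->; rewrite conjC0. Qed.

Lemma ReC x y : Re (dot y x) = Re (dot x y).
Proof. by rewrite dotC ReJ. Qed.
Lemma ImC x y : Im (dot y x) = - Im (dot x y).
Proof. by rewrite dotC ImJ. Qed.

Lemma sqZ a x : sq (a *: x) = abs2 a * sq x.
Proof.
by rewrite /sqnorm !dotE dotxx /abs2 !partE /=; ring.
Qed.
Lemma sqD x y : sq (x + y) = sq x + sq y + 2 * Re (dot x y).
Proof. rewrite /sqnorm !dotE !partE (ReC x y); ring. Qed.
Lemma sqB x y : sq (x - y) = sq x + sq y - 2 * Re (dot x y).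
Proof. rewrite /sqnorm !dotE !partE (ReC x y); ring. Qed.
Lemma sqN x : sq (- x) = sq x.
Proof. by rewrite /sqnorm !dotE opprK. Qed.

Lemma cauchy_schwarz x y : abs2 (dot x y) <= sq x * sq y.
Proof.
have [->|y0] := eqVneq y 0; first by rewrite dot0r sq0 mulr0 /abs2 /= expr0n addr0.
have := sq_ge0 ((sq y)%:C *: x - dot x y *: y).
rewrite sqB !sqZ !dotE abs2_realC.
have -> : 2 * Re ((sq y)%:C * ((dot x y)^* * dot x y)) = 2 * sq y * abs2 (dot x y).
  by rewrite /abs2 !partE /=; ring.
move=> h; have := sq_gt0 y0; rewrite -(ler_pM2l (sq_gt0 y0)) => h2.
nra.
Qed.

Lemma cauchy_schwarz_eq x y :
  abs2 (dot x y) = sq x * sq y -> (sq y)%:C *: x = dot x y *: y.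
Proof.
move=> e; apply/eqP; rewrite -subr_eq0 -sq_eq0; apply/eqP.
rewrite sqB !sqZ !dotE abs2_realC.
have -> : 2 * Re ((sq y)%:C * ((dot x y)^* * dot x y)) = 2 * sq y * abs2 (dot x y).
  by rewrite /abs2 !partE /=; ring.
rewrite e; ring.
Qed.

Lemma unit_exists x : x != 0 -> exists a, a != 0 /\ sq (a *: x) = 1.
Proof.
move=> x0; exists (Num.sqrt (sq x))^-1%:C; have s0 := sq_gt0 x0.
have s1 : Num.sqrt (sq x) != 0 by rewrite sqrtr_eq0 -ltNge.
split; first by rewrite -[0]/(0%:C) (inj_eq (@complexI _)) invr_eq0.
by rewrite sqZ abs2_realC exprVn sqr_sqrtr ?sq_ge0// mulVf// gt_eqF.
Qed.

(** Polarisation: the real part comes from [x + y], the imaginary part from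
    replacing [x] by [i x]. *)
Lemma isometry_dot (U : H -> H) : linear U -> (forall x, sq (U x) = sq x) ->
  forall x y, dot (U x) (U y) = dot x y.
Proof.
move=> Ul Us; have UD x y : U (x + y) = U x + U y by rewrite -[x]scale1r Ul !scale1r.
have U0 : U 0 = 0 by have := UD 0 0; rewrite addr0 -{1}[U 0]addr0 => /addrI.
have UZ a x : U (a *: x) = a *: U x by rewrite -[a *: x]addr0 Ul U0 addr0.
have ReE x y : Re (dot (U x) (U y)) = Re (dot x y).
  by have := Us (x + y); rewrite UD !sqD !Us; lra.
move=> x y; apply: complex_ext => //.
by have := ReE ('i *: x) y; rewrite UZ !dotZl !partE /=; lra.
Qed.

End InnerProduct.

(** * Orthonormal families *)

Section Frames.
Context {R : realType} {H : normedModType R[i]}.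
Variable dot : {dot H for (@Num.conj R[i])}.
Local Notation Re := complex.Re.
Local Notation sq := (sqnorm dot).

(** The families of the numerical range, as functions on ['I_n], so that they
    can be reindexed and mapped without going through tuples. *)
Definition frame n (e : 'I_n -> H) := forall i j, dot (e i) (e j) = (i == j)%:R.

Definition has_frame n := exists e : 'I_n -> H, frame e.

Lemma frame_nth n (s : seq H) (f : 'I_n -> nat) :
  orthonormal dot s -> injective f -> (forall i, f i < size s)%N ->
  frame (fun i => nth 0 s (f i)).
Proof.
move=> /orthonormalP[us os] fI fs i j.
by rewrite os ?mem_nth// nth_uniq// (inj_eq fI).
Qed.

Lemma frame_tnth n (e : n.-tuple H) : orthonormal dot e -> frame (tnth e).
Proof.
move=> oe i j.
by have := frame_nth oe (@ord_inj n); rewrite size_tuple => /(_ (@ltn_ord n) i j);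
  rewrite -!tnth_nth.
Qed.

Lemma frame_orthonormal n (e : 'I_n -> H) :
  frame e -> orthonormal dot [tuple e i | i < n].
Proof.
move=> fe; have eI : injective e.
  move=> i j ij; apply/eqP; have := fe i j; rewrite ij fe eqxx.
  by case: eqP => // _ /eqP; rewrite oner_eq0.
apply/orthonormalP; split; first by rewrite map_inj_uniq ?enum_uniq.
by move=> x y /mapP[i _ ->] /mapP[j _ ->]; rewrite fe (inj_eq eI).
Qed.

Lemma dot_frame n (e : 'I_n -> H) (v : 'I_n -> R[i]) j : frame e ->
  dot (\sum_i v i *: e i) (e j) = v j.
Proof.
move=> fe; rewrite dot_suml (bigD1 j)//= dotZl fe eqxx mulr1 big1 ?addr0// => i ij.
by rewrite dotZl fe (negbTE ij) mulr0.
Qed.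

Lemma sq_frame n (e : 'I_n -> H) (v : 'I_n -> R[i]) : frame e ->
  sq (\sum_i v i *: e i) = \sum_i abs2 (v i).
Proof.
move=> fe; apply: (@complexI R); rewrite -dotxx dot_sumr rmorph_sum /=.
by apply: eq_bigr => i _; rewrite dotZr dot_frame// abs2E mulrC.
Qed.

Lemma bessel_defect n (e : 'I_n -> H) (v : H) : frame e ->
  sq (v - \sum_i dot v (e i) *: e i) = sq v - \sum_i abs2 (dot v (e i)).
Proof.
move=> fe; rewrite sqB sq_frame// dot_sumr Re_sum.
suff -> : \sum_i Re (dot v (dot v (e i) *: e i)) = \sum_i abs2 (dot v (e i)).
  ring.
by apply: eq_bigr => i _; rewrite dotZr /abs2 !partE; ring.
Qed.

Lemma bessel n (e : 'I_n -> H) (v : H) : frame e ->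
  \sum_i abs2 (dot v (e i)) <= sq v.
Proof. by move=> fe; rewrite -subr_ge0 -bessel_defect// sq_ge0. Qed.

(** A nonzero combination of the [g i] orthogonal to [s] is a solution of
    [size s] linear equations in [n] unknowns. *)
Lemma unit_orthogonal n (g : 'I_n -> H) (s : seq H) : frame g -> (size s < n)%N ->
  exists w, sq w = 1 /\ forall x, x \in s -> dot w x = 0.
Proof.
move=> fg sn; pose A := \matrix_(i < n, j < size s) dot (g i) (nth 0 s j).
have : kermx A != 0.
  rewrite kermx_eq0 /row_free neq_ltn.
  by rewrite (leq_ltn_trans (rank_leq_col A) sn).
move=> /rowV0Pn[v /sub_kermxP vA v0].
pose w := \sum_i v 0 i *: g i.
have ow x : x \in s -> dot w x = 0.
  move=> /(nthP 0)[j js <-]; have := congr1 (fun B : 'rV__ => B 0 (Ordinal js)) vA.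
  rewrite !mxE => e; rewrite /w dot_suml -[RHS]e; apply: eq_bigr => i _.
  by rewrite dotZl mxE.
have w0 : w != 0.
  apply: contra v0 => /eqP w0; apply/eqP/rowP => j.
  by rewrite mxE -(dot_frame (fun i => v 0 i) j fg) -/w w0 dot0l.
have [a [a0 a1]] := unit_exists dot w0; exists (a *: w); split=> // x xs.
by rewrite dotZl ow// mulr0.
Qed.

Lemma orthonormal_rcons s w : orthonormal dot s -> sq w = 1 ->
  (forall x, x \in s -> dot w x = 0) -> orthonormal dot (rcons s w).
Proof.
move=> os w1 ow; rewrite -cats1 orthonormal_cat os /= /orthonormal /= dotxx w1.
rewrite eqxx/= /orthogonal/=; apply/allP => x xs /=.
by rewrite andbT (dot_eq0C (ow _ xs)).
Qed.

Lemma orthonormal_extend n s : has_frame n -> orthonormal dot s -> (size s <= n)%N ->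
  exists t, orthonormal dot (s ++ t) /\ size (s ++ t) = n.
Proof.
move=> [g fg] os; move: {-1}(n - size s)%N (erefl (n - size s)%N) => m.
elim: m s os => [|m IH] s os ms sn.
  by exists [::]; rewrite cats0; split=> //; lia.
have [w [w1 ow]] : exists w, sq w = 1 /\ forall x, x \in s -> dot w x = 0.
  by apply: (unit_orthogonal fg); rewrite -subn_gt0 ms.
have [||t [ot st]] := IH _ (orthonormal_rcons os w1 ow); rewrite ?size_rcons; try lia.
by exists (w :: t); rewrite -cat_rcons.
Qed.

(** A defect in Bessel's inequality would be a direction orthogonal to [e],
    hence would give one more orthonormal vector. *)
Lemma parseval n (e : 'I_n -> H) (v : H) : ~ has_frame n.+1 -> frame e ->
  \sum_i abs2 (dot v (e i)) = sq v.
Proof.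
move=> nf fe; apply/eqP; rewrite eq_sym -subr_eq0 -bessel_defect// sq_eq0.
apply: contrapT => /negP/(unit_exists dot)[a [_ a1]]; apply: nf.
set d := v - _ in a1 *.
have od x : x \in [tuple e i | i < n] -> dot (a *: d) x = 0.
  by move=> /mapP[i _ ->]; rewrite dotZl dotBl dot_frame// subrr mulr0.
have := orthonormal_rcons (frame_orthonormal fe) a1 od.
move=> /(@frame_nth n.+1)-/(_ (@nat_of_ord _) (@ord_inj _)) h.
eexists; apply: h => i; rewrite size_rcons size_tuple //.
Qed.

Lemma hilbert_dim_frame n : hilbert_dim_ge dot n -> has_frame n.
Proof.
move=> [E [[E1 E2] _] /pcard_leP[f]].
exists (fun i : 'I_n => f (i : nat)) => i j.
have Ef (k : 'I_n) : E (f (k : nat)) by apply: funS; rewrite /= ltn_ord.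
have [->|ij] := eqVneq i j; first by rewrite E1.
apply: E2 => //; apply: contra ij => /eqP fij; apply/eqP/val_inj.
apply: (inj (f := f)) fij; rewrite inE /=; exact: ltn_ord.
Qed.
End Frames.

(** * The range of an operator of rank one *)

Section Extremal.
Context {R : realType} {H : normedModType R[i]}.
Variable dot : {dot H for (@Num.conj R[i])}.
Local Notation Re := complex.Re.
Local Notation Im := complex.Im.
Local Notation sq := (sqnorm dot).
Local Notation frame := (frame dot).
Local Notation has_frame := (has_frame dot).
Variables (k : nat) (c : nat -> R).
Hypothesis k_gt1 : (1 < k)%N.
Hypothesis k_frame : has_frame k.
Hypothesis c_noninc : forall i j, (i <= j < k)%N -> c j <= c i.
Hypothesis c_lt : c k.-1 < c 0%N.

(** The quadratic form of [sum_i c_i e_i (x) e_i] at [v], or equivalently the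
    point of [W_c(v (x) v)] given by the family [e]. *)
Definition weight (e : 'I_k -> H) v : R := \sum_(i < k) c i * abs2 (dot v (e i)).

(** The maximum of [weight] is the first coefficient, reached when [e] starts
    along [p], except when all coefficients are negative and a family may avoid
    [p] altogether: then it is 0.  The booleans record which of the two occurs at each end.
    Avoiding a vector needs one more dimension, whence [k.+1]. *)
Lemma frame_with_endpoints (bM bm : bool) (p q : H) : bM || bm ->
  (~~ (bM && bm) -> has_frame k.+1) -> dot p q = 0 -> sq p = 1 -> sq q = 1 ->
  exists2 e, frame e & weight e p = (if bM then c 0%N else 0) /\
                       weight e q = (if bm then c k.-1 else 0).
Proof.
move=> bMm hf pq p1 q1.
have os : orthonormal dot [:: p; q].
  by apply/orthonormal2P; rewrite pq !dotxx p1 q1.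
pose N := if bM && bm then k else k.+1.
have [||t [ot st]] := @orthonormal_extend _ _ dot N [:: p; q] _ os.
- by rewrite /N; case: ifP hf => // _; apply.
- by rewrite /N /=; case: ifP; lia.
set s := _ ++ t in ot st.
(* [s] starts with [p] and [q]; [f] puts [p] first and [q] last when required
   and skips them otherwise. *)
pose f (i : 'I_k) : nat := if (val i == 0%N) && bM then 0%N else
  if (val i == k.-1) && bm then 1%N else i.+1 + ~~ bM.
have f_inj : injective f.
  move=> i j; rewrite /f => e; apply/val_inj => /=; move: e.
  move: (ltn_ord i) (ltn_ord j) bMm.
  by case: (bM); case: (bm) => //=; rewrite ?andbT ?andbF; repeat case: eqP; lia.
have f_lt i : (f i < size s)%N.
  rewrite st /f /N; move: (ltn_ord i) bMm.
  by case: (bM); case: (bm) => //=; rewrite ?andbT ?andbF; repeat case: eqP; lia.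
have f0 i : (f i == 0%N) = (val i == 0%N) && bM.
  rewrite /f; move: (ltn_ord i) bMm.
  by case: (bM); case: (bm) => //=; rewrite ?andbT ?andbF; repeat case: eqP; lia.
have f1 i : (f i == 1%N) = (val i == k.-1) && bm.
  rewrite /f; move: (ltn_ord i) bMm.
  by case: (bM); case: (bm) => //=; rewrite ?andbT ?andbF; repeat case: eqP; lia.
have fe := frame_nth ot f_inj f_lt.
exists (fun i => nth 0 s (f i)) => //.
have wE j x : (j < 2)%N -> nth 0 s j = x ->
    weight (fun i => nth 0 s (f i)) x = \sum_(i < k | f i == j) c i.
  move=> j2 sj; rewrite /weight [RHS]big_mkcond /=; apply: eq_bigr => i _.
  have js : (j < size s)%N by rewrite (leq_trans j2).
  have /orthonormalP[us os'] := ot.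
  rewrite -sj os' ?mem_nth// nth_uniq// eq_sym.
  by case: eqP => _; rewrite /abs2 /= ?expr1n ?expr0n addr0 ?mulr1 ?mulr0.
have k0 : (0 < k)%N by lia.
have kL : (k.-1 < k)%N by lia.
split; first rewrite (wE 0%N)//; last rewrite (wE 1%N)//.
- rewrite (eq_bigl _ _ f0); case: (bM) => /=; last by rewrite big_pred0// => i; rewrite andbF.
  by rewrite (big_pred1 (Ordinal k0))// => i; rewrite andbT.
rewrite (eq_bigl _ _ f1); case: (bm) => /=; last by rewrite big_pred0// => i; rewrite andbF.
by rewrite (big_pred1 (Ordinal kL))// => i; rewrite andbT.
Qed.

Lemma weight0 e : weight e 0 = 0.
Proof. by rewrite /weight big1// => i _; rewrite dot0l /abs2 /= expr0n addr0 mulr0. Qed.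

Lemma weightZ e a v : weight e (a *: v) = abs2 a * weight e v.
Proof.
rewrite /weight mulr_sumr; apply: eq_bigr => i _.
by rewrite dotZl abs2M mulrCA.
Qed.

Lemma exists_unit_orthogonal (p : H) : exists q, sq q = 1 /\ dot p q = 0.
Proof.
have [g fg] := k_frame.
have [//|q [q1 qo]] := @unit_orthogonal _ _ dot k g [:: p] fg.
by exists q; split=> //; apply/dot_eq0C/qo; rewrite mem_head.
Qed.

(** Bessel's inequality bounds [weight] by the extreme coefficients if these
    have the right signs.  If they do not and there is no room for [k.+1]
    orthonormal vectors, Parseval's identity does it; if there is room, 0 is
    the extreme value.  Simultaneous attainment on orthogonal vectors is what
    makes operators with two opposite eigenvalues tractable. *)
Lemma weight_extrema : exists M m : R,
  [/\ m < M, c 0%N + c k.-1 != 0 -> M + m != 0,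
      forall e v, frame e -> m * sq v <= weight e v <= M * sq v &
      forall p q, dot p q = 0 -> exists2 e, frame e &
        weight e p = M * sq p /\ weight e q = m * sq q].
Proof.
pose P := `[< has_frame k.+1 >].
pose bM := (0 <= c 0%N) || ~~ P; pose bm := (c k.-1 <= 0) || ~~ P.
have bMm : bM || bm.
  rewrite /bM /bm; case: (P); rewrite ?orbT//= !orbF.
  by case: leP => //= h; rewrite ltW// (lt_trans c_lt).
have hP : ~~ (bM && bm) -> has_frame k.+1.
  rewrite /bM /bm; case: (boolP P) => [/asboolP//|_]; by rewrite !orbT.
exists (if bM then c 0%N else 0), (if bm then c k.-1 else 0).
have c_bnd (i : 'I_k) : c k.-1 <= c i <= c 0%N.
  by rewrite !c_noninc//; have := ltn_ord i; lia.
split.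
- move: bMm; rewrite /bM /bm; case: (P); rewrite ?orbT ?orbF//=.
  by move: c_lt; case: (leP 0 (c 0%N)); case: (leP (c k.-1) 0) => //=; lra.
- move: bMm; rewrite /bM /bm; case: (P); rewrite ?orbT ?orbF//=.
  move: c_lt; case: (leP 0 (c 0%N)); case: (leP (c k.-1) 0) => //= h1 h2 h3 _ _.
    by rewrite addr0 gt_eqF// (lt_trans h1).
  by rewrite add0r lt_eqF// (lt_trans h3).
- move=> e v fe; have B := bessel v fe.
  have P0 : ~~ P -> \sum_i abs2 (dot v (e i)) = sq v.
    by move=> /asboolP nP; apply: parseval.
  set S := \sum_i _ in B P0.
  have S0 : 0 <= S by apply: sumr_ge0 => i _; apply: abs2_ge0.
  have h1 : c k.-1 * S <= weight e v.
    rewrite mulr_sumr; apply: ler_sum => i _.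
    by rewrite ler_wpM2r ?abs2_ge0//; case/andP: (c_bnd i).
  have h2 : weight e v <= c 0%N * S.
    rewrite mulr_sumr; apply: ler_sum => i _.
    by rewrite ler_wpM2r ?abs2_ge0//; case/andP: (c_bnd i).
  apply/andP; split; rewrite /bM /bm; case: (boolP P) P0 => _ P0; rewrite ?orbT ?orbF.
  + by case: (leP (c k.-1) 0) => h; nra.
  + by rewrite -P0.
  + by case: (leP 0 (c 0%N)) => h; nra.
  + by rewrite -P0.
- suff unit_case p q : dot p q = 0 -> sq p = 1 -> sq q = 1 ->
      forall a b, exists2 e, frame e &
        weight e (a *: p) = (if bM then c 0%N else 0) * sq (a *: p) /\
        weight e (b *: q) = (if bm then c k.-1 else 0) * sq (b *: q).
    have norm x : x != 0 -> exists a u, sq u = 1 /\ x = a *: u.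
      move=> /(unit_exists dot)[a [a0 a1]]; exists a^-1, (a *: x); split=> //.
      by rewrite scalerA mulVf// scale1r.
    move=> p q; have [->|/norm[a [u [u1 ->]]]] := eqVneq p 0.
      have [-> _|/norm[b [v [v1 ->]]] _] := eqVneq q 0.
        have [g fg] := k_frame; exists g => //.
        by rewrite !weight0 sq0 !mulr0.
      have [u [u1 uv]] := exists_unit_orthogonal v.
      by have := unit_case _ _ (dot_eq0C uv) u1 v1 0 b; rewrite scale0r.
    have [->|/norm[b [v [v1 ->]]]] := eqVneq q 0.
      have [v [v1 uv]] := exists_unit_orthogonal u.
      by have := unit_case _ _ uv u1 v1 a 0; rewrite scale0r.
    rewrite !dotE => /eqP; rewrite !mulf_eq0 conjC_eq0 => /or3P[] /eqP h.
    + have [v' [v1' uv]] := exists_unit_orthogonal v.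
      rewrite h scale0r.
      by have := unit_case _ _ (dot_eq0C uv) v1' v1 0 b; rewrite scale0r.
    + have [v' [v1' uv]] := exists_unit_orthogonal u.
      rewrite h scale0r.
      by have := unit_case _ _ uv u1 v1' a 0; rewrite scale0r.
    + exact: unit_case.
  move=> pq p1 q1 a b.
  have [e fe [eM em]] := frame_with_endpoints bMm hP pq p1 q1.
  by exists e; rewrite // !weightZ !sqZ p1 q1 eM em !mulr1 ![_ * abs2 _]mulrC.
Qed.

(** The point of [W_c(x (x) y)] given by the family [e]. *)
Definition pair_value (e : 'I_k -> H) x y : R[i] :=
  \sum_(i < k) (c i)%:C * (dot (e i) y * dot x (e i)).

(** Polarisation: the hermitian part of [x (x) y] is a difference of two
    squares; [a] and [b] leave room to make the two vectors orthogonal. *)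
Lemma Re_pair_value e x y (a b : R) :
  4 * (a * b) * Re (pair_value e x y) =
  weight e (a%:C *: x + b%:C *: y) - weight e (a%:C *: x - b%:C *: y).
Proof.
rewrite /pair_value Re_sum /weight -sumrB mulr_sumr; apply: eq_bigr => i _.
rewrite (dotC dot (e i) y) !dotE /abs2 !partE /=; ring.
Qed.

(** The added operator [x (x) (i t x)] is antihermitian. *)
Lemma Re_pair_value_shift e x y (t : R) :
  Re (pair_value e x (y + (t *i) *: x)) = Re (pair_value e x y).
Proof.
rewrite /pair_value !Re_sum; apply: eq_bigr => i _.
rewrite (dotC dot (e i)) (dotC dot (e i) y) !dotE !partE /=; ring.
Qed.

Lemma Re_pair_value0 e x : Re (pair_value e x 0) = 0.
Proof.
rewrite /pair_value Re_sum big1// => i _.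
by rewrite dot0r mul0r mulr0.
Qed.

Section Support.
Variables M m : R.
Hypothesis weight_bounds : forall e v, frame e -> m * sq v <= weight e v <= M * sq v.
Hypothesis weight_attained : forall p q, dot p q = 0 -> exists2 e, frame e &
        weight e p = M * sq p /\ weight e q = m * sq q.

(** With [a = |y|] and [b = |x|] the vectors [a x + b y] and [a x - b y] of the
    polarisation are orthogonal exactly because [<x, y>] is real, so the
    extreme weights can be reached on both at once. *)
Lemma pair_value_support_real x y : x != 0 -> Im (dot x y) = 0 -> exists w : R,
  [/\ 0 <= w, w ^+ 2 = sq x * sq y,
   forall e, frame e ->
     2 * Re (pair_value e x y) <= (M + m) * Re (dot x y) + (M - m) * w &
   exists2 e, frame e &
     2 * Re (pair_value e x y) = (M + m) * Re (dot x y) + (M - m) * w].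
Proof.
move=> x0 s0; have [->|y0] := eqVneq y 0.
  exists 0; rewrite sq0 mulr0 expr0n dot0r /= !mulr0 addr0; split=> // [e _|].
    by rewrite Re_pair_value0 mulr0.
  by have [e fe] := k_frame; exists e; rewrite // Re_pair_value0 mulr0.
pose a := Num.sqrt (sq y); pose b := Num.sqrt (sq x).
have a0 : 0 < a by rewrite sqrtr_gt0 sq_gt0.
have b0 : 0 < b by rewrite sqrtr_gt0 sq_gt0.
have a2 : a ^+ 2 = sq y by rewrite sqr_sqrtr ?sq_ge0.
have b2 : b ^+ 2 = sq x by rewrite sqr_sqrtr ?sq_ge0.
have ab0 : 0 < a * b by rewrite mulr_gt0.
pose p := a%:C *: x + b%:C *: y; pose q := a%:C *: x - b%:C *: y.
have pq : dot p q = 0.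
  apply: complex_ext; rewrite !dotE !partE /= !dotxx !(ReC dot x y) !(ImC dot x y) s0 /=.
    by rewrite -a2 -b2; ring.
  ring.
have sp : sq p = 2 * (a * b) * (a * b + Re (dot x y)).
  rewrite sqD !sqZ !abs2_realC !dotE !partE /= -a2 -b2; ring.
have sm : sq q = 2 * (a * b) * (a * b - Re (dot x y)).
  rewrite sqB !sqZ !abs2_realC !dotE !partE /= -a2 -b2; ring.
exists (a * b); split; first exact: ltW.
- by rewrite exprMn a2 b2 mulrC.
- move=> e fe; have /andP[_ hp] := weight_bounds p fe; have /andP[hq _] := weight_bounds q fe.
  have := Re_pair_value e x y a b; rewrite -/p -/q => E.
  rewrite -(ler_pM2l ab0); nra.
have [e fe [ep eq_]] := weight_attained pq; exists e => //.
have := Re_pair_value e x y a b; rewrite -/p -/q ep eq_ sp sm => E.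
apply: (mulfI (lt0r_neq0 ab0)); nra.
Qed.

(** Replacing [y] by [y + i t x] changes neither the real parts of the values
    nor that of [<x, y>], so [t] can be chosen to make [<x, y>] real; the
    squared norm of [y] drops by [(Im <x, y>)^2 / |x|^2]. *)
Lemma pair_value_support x y : exists w : R,
  [/\ 0 <= w, w ^+ 2 = sq x * sq y - Im (dot x y) ^+ 2,
   forall e, frame e ->
     2 * Re (pair_value e x y) <= (M + m) * Re (dot x y) + (M - m) * w &
   exists2 e, frame e &
     2 * Re (pair_value e x y) = (M + m) * Re (dot x y) + (M - m) * w].
Proof.
have [->|x0] := eqVneq x 0.
  have v0 e : Re (pair_value e 0 y) = 0.
    by rewrite /pair_value big1// => i _; rewrite dot0l !mulr0.
  exists 0; rewrite sq0 mul0r expr0n dot0l /= expr0n subr0 !mulr0 addr0.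
  split=> // [e _|]; first by rewrite v0 mulr0.
  by have [e fe] := k_frame; exists e; rewrite // v0 mulr0.
pose t := Im (dot x y) / sq x.
have tx : t * sq x = Im (dot x y) by rewrite divfK// sq_eq0.
have ReE : Re (dot x (y + (t *i) *: x)) = Re (dot x y).
  by rewrite !dotE dotxx !partE /=; ring.
have Im0 : Im (dot x (y + (t *i) *: x)) = 0.
  by rewrite !dotE dotxx !partE /= -tx; ring.
have sqE : sq x * sq (y + (t *i) *: x) = sq x * sq y - Im (dot x y) ^+ 2.
  rewrite sqD sqZ !dotE /abs2 !partE /= (ImC dot x y) -tx; ring.
have [w [w0 w2 ub [e fe ee]]] := pair_value_support_real x0 Im0.
exists w; rewrite -sqE -ReE; split=> // [e' fe'|].
  by rewrite -(Re_pair_value_shift e' x y t); apply: ub.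
by exists e; rewrite // -(Re_pair_value_shift e x y t).
Qed.

End Support.

Definition pair_range x y : set R[i] :=
  [set z | exists2 e, frame e & z = pair_value e x y].

Lemma pair_valueZ a e x y : pair_value e (a *: x) y = a * pair_value e x y.
Proof.
rewrite /pair_value mulr_sumr; apply: eq_bigr => i _.
by rewrite dotZl; ring.
Qed.

Lemma pair_rangeZ a x y x' y' : pair_range x y = pair_range x' y' ->
  pair_range (a *: x) y = pair_range (a *: x') y'.
Proof.
move=> e; apply/seteqP; split=> z [f ff ->].
  have : pair_range x y (pair_value f x y) by exists f.
  by rewrite e => -[g fg fgE]; exists g; rewrite // !pair_valueZ fgE.
have : pair_range x' y' (pair_value f x' y') by exists f.
by rewrite -e => -[g fg fgE]; exists g; rewrite // !pair_valueZ fgE.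
Qed.

(** Adding the support functions in two opposite directions gives the width of
    the range, hence [|a x|^2 |y|^2 - (Im a<x, y>)^2] for every scalar [a].
    The values at [1], [i] and [1 + i] determine [<x, y>^2], and then the
    product of the norms.  Subtracting the support functions instead gives the
    centre, which is [<x, y>] up to the factor [(M + m) / 2]. *)
Lemma pair_range_inj x y x' y' : pair_range x y = pair_range x' y' ->
  [/\ dot x y ^+ 2 = dot x' y' ^+ 2, sq x * sq y = sq x' * sq y' &
      c 0%N + c k.-1 != 0 -> dot x y = dot x' y'].
Proof.
move=> e0; have [M [m [mM Mm wb wa]]] := weight_extrema.
have key a : sq (a *: x) * sq y - Im (dot (a *: x) y) ^+ 2 =
             sq (a *: x') * sq y' - Im (dot (a *: x') y') ^+ 2 /\
             (M + m) * Re (dot (a *: x) y) = (M + m) * Re (dot (a *: x') y').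
  have half (b : R[i]) : exists w w' : R, [/\ 0 <= w, 0 <= w',
      w ^+ 2 = sq (b *: x) * sq y - Im (dot (b *: x) y) ^+ 2,
      w' ^+ 2 = sq (b *: x') * sq y' - Im (dot (b *: x') y') ^+ 2 &
      (M + m) * Re (dot (b *: x) y) + (M - m) * w =
      (M + m) * Re (dot (b *: x') y') + (M - m) * w'].
    have eb := pair_rangeZ b e0.
    have [w [w0 w2 ub [f ff fE]]] := pair_value_support wb wa (b *: x) y.
    have [w' [w0' w2' ub' [f' ff' fE']]] := pair_value_support wb wa (b *: x') y'.
    exists w, w'; split=> //; apply/eqP; rewrite eq_le; apply/andP; split.
      have : pair_range (b *: x) y (pair_value f (b *: x) y) by exists f.
      by rewrite eb -fE => -[g fg ->]; apply: ub'.
    have : pair_range (b *: x') y' (pair_value f' (b *: x') y') by exists f'.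
    by rewrite -eb -fE' => -[g fg ->]; apply: ub.
  have [w1 [w1' [p1 p1' q1 q1' r1]]] := half a.
  have [w2 [w2' [p2 p2' q2 q2' r2]]] := half (- a).
  rewrite !sqZ !dotE !partE in q1 q1' r1 q2 q2' r2 *.
  have sqN_ : abs2 (- a) = abs2 a by rewrite /abs2 !partE !sqrrN.
  rewrite sqN_ in q2 q2'.
  have e12 : w2 = w1.
    by apply/eqP; rewrite -(eqrXn2 (n := 2))// q1 q2; apply/eqP; ring.
  have e12' : w2' = w1'.
    by apply/eqP; rewrite -(eqrXn2 (n := 2))// q1' q2'; apply/eqP; ring.
  rewrite e12 e12' in r2.
  have ww : w1 = w1'.
    have Mm0 : M - m != 0 by rewrite subr_eq0 gt_eqF.
    by apply: (mulfI Mm0); lra.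
  split; first by rewrite -q1 -q1' ww.
  by move: r1 r2; rewrite ww; lra.
have [k1 r1] := key 1; have [k2 r2] := key 'i; have [k3 _] := key (1 + 'i).
move: k1 k2 k3 r1 r2; rewrite !sqZ !dotE /abs2 !partE /= => k1 k2 k3 r1 r2.
have dd : dot x y ^+ 2 = dot x' y' ^+ 2.
  apply: complex_ext; rewrite !expr2 !partE; nra.
have aa := abs2_sqr dd; rewrite /abs2 in aa.
split=> //; first nra.
move=> /Mm Mm0; apply: complex_ext; apply: (mulfI Mm0); nra.
Qed.
End Extremal.

(** * The Riesz representation theorem *)

Section Operators.
Context {R : realType} {H : completeNormedModType R[i]}.
Variable dot : {dot H for (@Num.conj R[i])}.
Hypothesis dotP : dot_induces_norm dot.
Local Notation Re := complex.Re.
Local Notation Im := complex.Im.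
Local Notation sq := (sqnorm dot).

Lemma normE (v : H) : `|v| = (Num.sqrt (sq v))%:C.
Proof.
apply/eqP; rewrite -(eqrXn2 (n := 2))// ?ler0c ?sqrtr_ge0//.
by rewrite dotP dotxx -rmorphXn /= sqr_sqrtr// sq_ge0.
Qed.

Lemma norm_lt_sq (v : H) (d : R[i]) : 0 < d -> (`|v| < d) = (sq v < Re d ^+ 2).
Proof.
move=> d0; have dE : d = (Re d)%:C by rewrite RRe_real// gtr0_real.
have d0' : 0 < Re d by rewrite -ltcR -dE.
rewrite {1}dE normE ltcR -[X in _ < X]gtr0_norm // -sqrtr_sqr ltr_sqrt//.
by rewrite exprn_gt0.
Qed.

Lemma sq_complete (u : nat -> H) :
  (forall d : R, 0 < d -> exists N, forall n, (N <= n)%N -> sq (u N - u n) < d) ->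
  exists y, forall d : R, 0 < d -> exists N, forall n, (N <= n)%N -> sq (y - u n) < d.
Proof.
move=> uC; have : cauchy (u @ \oo).
  apply: cauchy_exP => e e0.
  have e0' : 0 < Re e ^+ 2 by move: e0; rewrite ltcE /= => /andP[_ /exprn_gt0].
  have [N NP] := uC _ e0'; exists (u N); exists N => // n /= Nn.
  by rewrite -ball_normE /ball_ /= norm_lt_sq//; apply: NP.
move=> /cauchy_cvg /cvg_ex[y /cvgrPdist_lt uy].
exists y => d d0.
have s0 : (0 : R[i]) < (Num.sqrt d)%:C by rewrite -[0]/(0%:C) ltcR sqrtr_gt0.
have [N _ NP] := uy _ s0; exists N => n Nn.
have := NP n Nn; rewrite /= norm_lt_sq// /= sqr_sqrtr ?ltW//.
Qed.

(** The representing vector minimises [|x|^2 - 2 Re f x].  The parallelogram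
    identity makes a minimising sequence Cauchy; near-minimality of [u n] along
    the line of [x] bounds [Re <u n, x> - Re f x].  Passing to the limit only
    needs the Cauchy-Schwarz inequality, not the continuity of [f]. *)
Lemma riesz (f : H -> R[i]) (K : R) : scalar f -> (forall x, abs2 (f x) <= K ^+ 2 * sq x) ->
  exists y, forall x, f x = dot x y.
Proof.
move=> fL fB.
have fD x y : f (x + y) = f x + f y by rewrite -[x]scale1r fL mul1r scale1r.
have f0 : f 0 = 0 by have := fD 0 0; rewrite addr0 -{1}[f 0]addr0 => /addrI.
have fZ a x : f (a *: x) = a * f x by rewrite -[a *: x]addr0 fL f0 addr0.
pose g x : R := sq x - 2 * Re (f x).
have g_ge x : - K ^+ 2 <= g x.
  have := fB x; rewrite /abs2 /g; have := sq_ge0 dot x.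
  set s := sq x; set r := Re (f x); set j := Im (f x) => s0 h.
  rewrite leNgt; apply/negP => h2.
  have h3 : r ^+ 2 <= K ^+ 2 * s by apply: le_trans h; rewrite lerDl sqr_ge0.
  have h4 : s + K ^+ 2 < 2 * r by lra.
  have h5 : (s + K ^+ 2) ^+ 2 < (2 * r) ^+ 2.
    by rewrite ltr_pXn2r// nnegrE; have := sqr_ge0 K; lra.
  have := sqr_ge0 (s - K ^+ 2); nra.
pose eps n : R := n.+1%:R^-1.
pose I : R := inf (range g).
have gI : has_inf (range g).
  by split; [exists (g 0), 0|exists (- K ^+ 2) => _ [x _ <-]; apply: g_ge].
have I_le x : I <= g x by apply: ge_inf; [case: gI|exists x].
have /choice[u uP] : forall n : nat, exists x, g x < I + eps n.
  move=> n; have n0 : 0 < eps n by rewrite invr_gt0 ltr0n.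
  by have [_ [x _ <-] xI] := inf_adherent n0 gI; exists x.
have par x y : sq (x - y) = 2 * g x + 2 * g y - 4 * g ((2^-1)%:C *: (x + y)).
  rewrite /g sqB sqZ sqD abs2_realC fZ fD !partE /=; field; done.
have small (d : R) : 0 < d -> exists N, forall n, (N <= n)%N -> eps n < d.
  move=> d0; exists (Num.truncn d^-1) => n Nn.
  rewrite /eps invf_plt ?posrE//; apply: lt_le_trans (truncnS_gt _) _.
  by rewrite ler_nat.
have uC (d : R) : 0 < d -> exists N, forall n, (N <= n)%N -> sq (u N - u n) < d.
  move=> d0; have [N NP] := small (d / 4) (divr_gt0 d0 (ltr0n _ 4)).
  exists N => n Nn; rewrite par.
  have := NP N (leqnn _); have := NP n Nn; have := uP N; have := uP n.
  by have := I_le ((2^-1)%:C *: (u N + u n)); lra.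
have [y yP] := sq_complete uC.
have var n x : (Re (dot (u n) x) - Re (f x)) ^+ 2 <= eps n * sq x.
  have [->|x0] := eqVneq x 0; first by rewrite dot0r f0 subrr expr0n sq0 mulr0.
  set D : R := _ - _; set t : R := - D / sq x.
  have := I_le (u n + t%:C *: x); rewrite {1}/g sqD sqZ abs2_realC fD fZ dotZr !partE /=.
  have := uP n; rewrite {1}/g => h1 h2.
  have tE : t * sq x = - D by rewrite divfK// sq_eq0.
  have h : 0 <= t ^+ 2 * sq x + 2 * t * D + eps n by rewrite /D; lra.
  have := mulr_ge0 h (sq_ge0 dot x).
  have -> : (t ^+ 2 * sq x + 2 * t * D + eps n) * sq x =
    (t * sq x) ^+ 2 + 2 * (t * sq x) * D + eps n * sq x by ring.
  rewrite tE; lra.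
have ReE x : Re (f x) = Re (dot x y).
  apply/eqP; rewrite -subr_eq0 -sqrf_eq0 eq_le sqr_ge0 andbT leNgt; apply/negP.
  set D : R := _ - _ => D0.
  have x0 : x != 0 by apply: contraTneq D0 => x0; rewrite /D x0 f0 dot0l subrr expr0n ltxx.
  have s0 := sq_gt0 dot x0.
  pose d : R := D ^+ 2 / (4 * sq x); have d0 : 0 < d by rewrite divr_gt0// mulr_gt0.
  have dE : d * sq x = D ^+ 2 / 4 by rewrite /d; field; rewrite sq_eq0.
  have [N1 h1] := yP _ d0; have [N2 h2] := small _ d0.
  pose n := maxn N1 N2.
  have {}h1 := h1 n (leq_maxl _ _); have {}h2 := h2 n (leq_maxr _ _).
  have h3 := var n x.
  have h4' : Re (dot (y - u n) x) ^+ 2 <= sq (y - u n) * sq x.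
    by apply: le_trans (cauchy_schwarz dot _ _); rewrite lerDl sqr_ge0.
  have DE : D = - (Re (dot (u n) x) - Re (f x)) - Re (dot (y - u n) x).
    by rewrite /D (ReC dot y x) dotBl !partE; ring.
  move: h3 h4' DE; set A : R := _ - _; set B : R := Re _ => h3 h4' DE.
  have h5 : D ^+ 2 <= 2 * A ^+ 2 + 2 * B ^+ 2.
    by rewrite DE; have := sqr_ge0 (A - B); nra.
  have : eps n * sq x < d * sq x by rewrite ltr_pM2r.
  have : sq (y - u n) * sq x < d * sq x by rewrite ltr_pM2r.
  lra.
exists y => x; apply: complex_ext => //.
have := ReE ('i *: x); rewrite fZ dotZl !partE /=; lra.
Qed.
End Operators.

(** * Maps preserving squares of inner products *)

Section FiniteUnions.
Context {R : realType} {H : normedModType R[i]}.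
Variable dot : {dot H for (@Num.conj R[i])}.

Definition subspace (S : set H) :=
  forall (a : R[i]) x y, S x -> S y -> S (a *: x + y).

(** A vector space over an infinite field is not a finite union of proper
    subspaces.  If [w] avoids all but the last subspace and [v] avoids the last,
    then some [v + t w] with [t] an integer avoids all of them: two values of
    [t] cannot fall in the same subspace. *)
Lemma subspaces_avoid n (S : 'I_n -> set H) :
  (forall i, subspace (S i)) -> (forall i, exists v, ~ S i v) ->
  exists w, forall i, ~ S i w.
Proof.
elim: n S => [|n IH] S Ssub Sv; first by exists 0 => -[].
have [i|i|w wS] := IH (fun i => S (lift ord_max i)); [exact: Ssub|exact: Sv|].
have [v vS] := Sv ord_max.
have [Sw|] := pselect (S ord_max w); last first.
  by move=> nSw; exists w => i; case: (unliftP ord_max i) => [j ->|->]; [apply: wS|].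
have nS t : ~ S ord_max (v + t *: w).
  by move=> h; apply: vS; have := Ssub _ (- t) _ _ Sw h; rewrite addrC scaleNr addrK.
apply: contrapT => /forallNP no.
have /choice[f fP] : forall t : 'I_n.+1, exists i : 'I_n,
    S (lift ord_max i) (v + t%:R *: w).
  move=> t; have := no (v + t%:R *: w) => /existsNP[i /contrapT].
  by case: (unliftP ord_max i) => [j ->|-> /nS//]; exists j.
have fI : injective f.
  move=> s t fst; apply/eqP; apply: contra_notT (wS (f s)) => st.
  have h1 := fP s; have h2 := fP t; rewrite -fst in h2.
  have sub := Ssub (lift ord_max (f s)).
  have h3 := sub (-1) _ _ h1 h2; have h0 := sub (-1) _ _ h1 h1.
  rewrite scaleN1r addNr in h0.
  have c0 : t%:R - s%:R != 0 :> R[i].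
    by rewrite subr_eq0 eqr_nat eq_sym.
  have := sub (t%:R - s%:R)^-1 _ _ h3 h0.
  rewrite addr0 scaleN1r opprD addrACA addNr add0r -scaleNr -scalerDl scalerA.
  by rewrite [- _ + _]addrC mulVf// scale1r.
by have := leq_card f fI; rewrite !card_ord ltnn.
Qed.

Lemma dot_cover (s : seq H) :
  (forall w, exists2 v, v \in s & dot v w = 0) -> 0 \in s.
Proof.
move=> cov; apply: contrapT => /negP s0.
have [i a x y|i|w wP] := @subspaces_avoid (size s) (fun i w => dot s`_i w = 0).
- by rewrite dotDr dotZr => -> ->; rewrite mulr0 addr0.
- exists s`_i => /eqP; rewrite dotxx_eq0; apply/negP; apply: contraNN s0 => /eqP <-.
  exact: mem_nth.
have [v /(nthP 0)[j js <-]] := cov w; exact: (wP (Ordinal js)).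
Qed.

Lemma nonorthogonal2 (x y : H) : x != 0 -> y != 0 ->
  exists w, dot x w != 0 /\ dot y w != 0.
Proof.
move=> x0 y0; apply: contrapT => /forallNP no.
suff : 0 \in [:: x; y] by rewrite !inE ![0 == _]eq_sym (negbTE x0) (negbTE y0).
apply: dot_cover => w; have /not_andP[] := no w.
- by move=> /negP/negPn/eqP xw; exists x; rewrite ?inE ?eqxx.
- by move=> /negP/negPn/eqP yw; exists y; rewrite ?inE ?eqxx ?orbT.
Qed.

(** Every [y] is orthogonal to [a - b] or to [a + b]. *)
Lemma eq_dot_sqr (a b : H) : (forall y, dot a y ^+ 2 = dot b y ^+ 2) ->
  a = b \/ a = - b.
Proof.
move=> ab; have : 0 \in [:: a - b; a + b].
  apply: dot_cover => w; have /eqP := ab w; rewrite eqf_sqr => /orP[]/eqP e.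
  - by exists (a - b); rewrite ?inE ?eqxx// dotBl e subrr.
  - by exists (a + b); rewrite ?inE ?eqxx ?orbT// dotDl e addNr.
rewrite !inE ![0 == _]eq_sym subr_eq0 addr_eq0 => /orP[]/eqP; by [left|right].
Qed.

(** A sign that may depend on the vector is constant: the space is the union of
    the kernels of [f - g] and [f + g]. *)
Lemma linear_pm (f g : {linear H -> H}) : (forall x, f x = g x \/ f x = - g x) ->
  (forall x, f x = g x) \/ (forall x, f x = - g x).
Proof.
move=> fg; apply: contrapT => /not_orP[/existsNP n1 /existsNP n2].
pose S (i : 'I_2) : set H := if i == 0 then [set x | f x = g x] else [set x | f x = - g x].
have [i a x y|i|w wP] := @subspaces_avoid 2 S.
- by rewrite /S; case: eqP => _ /= e1 e2; rewrite !linearP e1 e2 ?scalerN ?opprD.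
- by rewrite /S; case: eqP.
have := wP 0; have := wP 1; rewrite /S /=; have := fg w; tauto.
Qed.

Section SignedIsometry.
Variable f : H -> H.
Hypothesis f_surj : forall w, exists x, w = f x \/ w = - f x.
Hypothesis f_dot : forall x y, dot (f x) (f y) ^+ 2 = dot x y ^+ 2.

(** Against any [f w], the numbers [p], [q], [r] below have the squares of
    [s + t], [s], [t], so [p] equals one of the four combinations of [q] and
    [r] with signs; thus the four vectors [v] cover the space by their
    orthogonals, and one of them vanishes. *)
Lemma signed_add x z : exists s t : bool,
  f (x + z) = (-1) ^+ s *: f x + (-1) ^+ t *: f z.
Proof.
pose v (s t : bool) := f (x + z) - ((-1) ^+ s *: f x + (-1) ^+ t *: f z).
suff : 0 \in [:: v true true; v true false; v false true; v false false].
  by rewrite !inE ![0 == _]eq_sym !subr_eq0 => /or4P[]/eqP;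
    [exists true, true|exists true, false|exists false, true|exists false, false].
suff cov w : exists2 v', v' \in [:: v true true; v true false; v false true; v false false]
    & dot v' (f w) = 0.
  apply: dot_cover => w'; have [w ww'] := f_surj w'; have [v' iv' vw] := cov w.
  by exists v' => //; case: ww' => ->; rewrite ?dotNr vw ?oppr0.
have := f_dot (x + z) w; have := f_dot x w; have := f_dot z w; rewrite dotDl.
set p := dot (f (x + z)) _; set q := dot (f x) _; set r := dot (f z) _.
set s := dot x w; set t := dot z w => er eq_ ep.
have : (p + q + r) * (p + q - r) * (p - q + r) * (p - q - r) = 0.
  transitivity ((p ^+ 2 + q ^+ 2 - r ^+ 2) ^+ 2 - 4 * p ^+ 2 * q ^+ 2); first by ring.
  rewrite er eq_ ep; ring.
have vE b1 b2 : dot (v b1 b2) (f w) = p - ((-1) ^+ b1 * q + (-1) ^+ b2 * r).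
  by rewrite /v !dotE.
move=> /eqP; rewrite !mulf_eq0 -!orbA => /or4P[]/eqP e.
- exists (v true true); rewrite ?inE ?eqxx// vE -[RHS]e expr1; ring.
- exists (v true false); rewrite ?inE ?eqxx ?orbT// vE -[RHS]e expr1 expr0; ring.
- exists (v false true); rewrite ?inE ?eqxx ?orbT// vE -[RHS]e expr1 expr0; ring.
- exists (v false false); rewrite ?inE ?eqxx ?orbT// vE -[RHS]e expr0; ring.
Qed.

Lemma signed_scale a x : exists s : bool, f (a *: x) = (-1) ^+ s *: (a *: f x).
Proof.
have [|->|->] := @eq_dot_sqr (f (a *: x)) (a *: f x).
- move=> y; have [w [->|->]] := f_surj y;
  by rewrite ?dotNr ?sqrrN f_dot !dotZl !exprMn ?dotNr ?sqrrN f_dot.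
- by exists false; rewrite expr0 scale1r.
- by exists true; rewrite expr1 scaleN1r.
Qed.

(** From here on the sign of [f x] is normalised by the linear functional
    [x |-> <x, e0>] wherever that functional does not vanish. *)
Variables e0 u0 : H.
Hypothesis e0_unit : dot e0 e0 = 1.
Hypothesis f_normal : forall x, dot (f x) u0 = dot x e0.

(** The functional takes the value [a + b] at [x + z], and none of
    [a - b], [- a + b], [- a - b] equals [a + b] when [a], [b] and [a + b] are
    nonzero, so the two signs are determined. *)
Lemma normal_add x z : dot x e0 != 0 -> dot z e0 != 0 -> dot (x + z) e0 != 0 ->
  f (x + z) = f x + f z.
Proof.
move=> x0 z0 xz0; have [s [t e]] := signed_add x z.
have := congr1 (dot^~ u0) e; rewrite /= !dotE !f_normal !dotE; move: e xz0; rewrite dotDl.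
move: (dot x e0) (dot z e0) x0 z0 => a b a0 b0 e ab0 eab.
have two0 (y : R[i]) : y = - y -> y = 0.
  by move=> /eqP; rewrite -subr_eq0 opprK -mulr2n mulrn_eq0 /= => /eqP.
case: s t e eab => -[] ->; rewrite ?expr1 ?expr0 ?scale1r ?scaleN1r ?mul1r ?mulN1r // => h.
- by case/eqP: ab0; apply: two0; rewrite {1}h opprD.
- by case/eqP: a0; apply: two0; apply: (addIr b).
- by case/eqP: b0; apply: two0; apply: (addrI a).
Qed.

Lemma normal_scale a x : a != 0 -> dot x e0 != 0 -> f (a *: x) = a *: f x.
Proof.
move=> a0 x0; have [s e] := signed_scale a x.
have := congr1 (dot^~ u0) e; rewrite /= !dotE !f_normal !dotE => eab.
case: s e eab => -> //; rewrite ?expr0 ?scale1r// expr1 mulN1r => /eqP.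
rewrite -subr_eq0 opprK -mulr2n mulrn_eq0 /= mulf_eq0 (negbTE a0) (negbTE x0) //.
Qed.

(** [f] is linear off the hyperplane orthogonal to [e0].  On the hyperplane,
    where the normalisation says nothing, the linear extension is obtained by
    translating by [e0]. *)
Lemma normal_linear : exists2 U : H -> H, linear U & forall x, f x = U x \/ f x = - U x.
Proof.
pose g h := f (h + e0) - f e0.
have gD h h' : dot h e0 = 0 -> dot h' e0 = 0 -> g (h + h') = g h + g h'.
  move=> h0 h0'; rewrite /g.
  have e1 : f (h + h' + e0 + e0) = f (h + h' + e0) + f e0.
    by apply: normal_add; rewrite ?dotDl ?h0 ?h0' ?e0_unit ?add0r ?oner_eq0// -mulr2n pnatr_eq0.
  have e2 : f (h + h' + e0 + e0) = f (h + e0) + f (h' + e0).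
    rewrite -[h + h' + e0 + e0]addrA addrACA.
    by apply: normal_add; rewrite ?dotDl ?h0 ?h0' ?e0_unit ?add0r ?oner_eq0// -mulr2n pnatr_eq0.
  have -> : f (h + h' + e0) = f (h + e0) + f (h' + e0) - f e0.
    by rewrite -e2 e1 addrK.
  by rewrite [RHS]addrACA addrA.
have gZ a h : dot h e0 = 0 -> g (a *: h) = a *: g h.
  move=> h0; have g0 : g 0 = 0 by rewrite /g add0r subrr.
  have gpos b : b != 0 -> b + 1 != 0 -> g (b *: h) = b *: g h.
    move=> b0 b1; rewrite /g.
    have e1 : f (b *: (h + e0) + e0) = f (b *: h + e0) + f (b *: e0).
      rewrite scalerDr addrAC.
      by apply: normal_add; rewrite ?dotDl ?dotZl ?h0 ?e0_unit ?mulr0 ?mulr1 ?add0r ?oner_eq0// addrC.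
    have e2 : f (b *: (h + e0) + e0) = f (b *: (h + e0)) + f e0.
      by apply: normal_add; rewrite ?dotDl ?dotZl ?dotDl ?h0 ?e0_unit ?add0r ?mulr1 ?oner_eq0.
    rewrite e1 !normal_scale ?dotDl ?h0 ?e0_unit ?add0r ?oner_eq0// in e2.
    have -> : f (b *: h + e0) = b *: f (h + e0) + f e0 - b *: f e0 by rewrite -e2 addrK.
    by rewrite scalerBr addrAC addrK.
  have [->|a0] := eqVneq a 0; first by rewrite !scale0r.
  have [a1|a1] := eqVneq (a + 1) 0; last exact: gpos.
  move/eqP: a1; rewrite addr_eq0 => /eqP ->; rewrite !scaleN1r.
  by apply/eqP; rewrite -addr_eq0 addrC -gD ?dotNl ?h0 ?oppr0// subrr g0.
pose U x := g (x - dot x e0 *: e0) + dot x e0 *: f e0.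
have orth x : dot (x - dot x e0 *: e0) e0 = 0.
  by rewrite dotBl dotZl e0_unit mulr1 subrr.
have U_lin : linear U.
  move=> a x y; rewrite /U !dotDl !dotZl.
  have -> : a *: x + y - (a * dot x e0 + dot y e0) *: e0 =
      a *: (x - dot x e0 *: e0) + (y - dot y e0 *: e0).
    by rewrite scalerBr scalerDl scalerA opprD addrACA.
  rewrite (gD (a *: _)) ?gZ ?dotZl ?orth ?mulr0//.
  by rewrite scalerDl [in RHS]scalerDr scalerA addrACA.
exists U => // x; rewrite /U.
have [x0|x0] := eqVneq (dot x e0) 0.
  rewrite x0 !scale0r subr0 addr0 /g.
  have [s [t e]] := signed_add (x + e0) (- e0).
  have [r er] := signed_scale (-1) e0; rewrite !scaleN1r in er.
  rewrite addrK er in e; clear er.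
  have := congr1 (dot^~ u0) e; rewrite /= !dotE !f_normal !dotE x0 e0_unit add0r mulr1.
  case: s e => e; case: t e => e; case: r e => -> /=;
    rewrite ?expr1 ?expr0 ?scale1r ?scaleN1r ?mulN1r ?mul1r ?opprK;
    first [by move=> _; rewrite ?opprB ?[- f (x + e0) + _]addrC; tauto
          |by move=> /eqP; rewrite eq_sym -?opprD ?oppr_eq0 -mulr2n pnatr_eq0].
left; rewrite -{1}[x](subrK (dot x e0 *: e0)).
set h := x - _; set a := dot x e0 in x0 h *.
have -> : h + a *: e0 = a *: (a^-1 *: h + e0).
  by rewrite scalerDr scalerA mulfV// scale1r.
rewrite normal_scale//; last first.
  by rewrite dotDl dotZl orth mulr0 add0r e0_unit oner_eq0.
have -> : f (a^-1 *: h + e0) = g (a^-1 *: h) + f e0 by rewrite subrK.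
by rewrite gZ ?orth// scalerDr scalerA mulfV// scale1r.
Qed.

End SignedIsometry.

(** Wigner's theorem with signs in place of phases. *)
Theorem signed_isometry (f : H -> H) (e0 : H) :
  (forall w, exists x, f x = w) ->
  (forall x y, dot (f x) (f y) ^+ 2 = dot x y ^+ 2) -> dot e0 e0 = 1 ->
  exists2 U : H -> H, linear U & forall x, f x = U x \/ f x = - U x.
Proof.
move=> fs fd e1.
have /choice[f' f'P] : forall x, exists u, (u = f x \/ u = - f x) /\ dot u (f e0) = dot x e0.
  move=> x; have /eqP := fd x e0; rewrite eqf_sqr => /orP[]/eqP e.
    by exists (f x); split; [left|].
  by exists (- f x); split; [right|rewrite dotNl e opprK].
have [|||U Ul UP] := @normal_linear f' _ _ e0 (f e0) e1.
- move=> w; have [x <-] := fs w; exists x; have [[->|->] _] := f'P x; first by left.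
  by right; rewrite opprK.
- move=> x y; have [+ _] := f'P x; have [+ _] := f'P y.
  by move=> [->|->] [->|->]; rewrite ?dotNl ?dotNr ?sqrrN.
- by move=> x; have [_] := f'P x.
exists U => // x; have [+ _] := f'P x; have := UP x.
by move=> [->|->] [e|e]; [left|right; rewrite e opprK|right|left; apply: oppr_inj].
Qed.
End FiniteUnions.

(** * Operators of rank one *)

Section RankOne.
Context {R : realType} {H : completeNormedModType R[i]}.
Variable dot : {dot H for (@Num.conj R[i])}.
Hypothesis dotP : dot_induces_norm dot.
Local Notation Re := complex.Re.
Local Notation sq := (sqnorm dot).

Fact rank1_linear (x y : H) : linear (fun z => dot z y *: x).
Proof. by move=> a u v; rewrite dotDl dotZl scalerDl scalerA. Qed.

Fact rank1_bounded (x y : H) :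
  exists M : R, forall z, `|dot z y *: x| <= M%:C * `|z|.
Proof.
exists (Num.sqrt (sq y * sq x)) => z.
rewrite !(normE dotP) -rmorphM lecR -sqrtrM ?mulr_ge0 ?sq_ge0// ler_sqrt; last first.
  by rewrite !mulr_ge0 ?sq_ge0.
rewrite sqZ [leRHS]mulrAC ler_wpM2r ?sq_ge0//.
by rewrite [leRHS]mulrC; apply: cauchy_schwarz.
Qed.

(** The operator [x (x) y]; the bound is the Cauchy-Schwarz inequality. *)
Definition rank1 (x y : H) : bop H := BOp (rank1_linear x y) (rank1_bounded x y).

Lemma bopM_rank1 A x y : bopM A (rank1 x y) = rank1 (A x) y.
Proof. by apply: bop_ext => z /=; rewrite linearZ. Qed.

Lemma rank1_0l y : rank1 0 y = bop0.
Proof. by apply: bop_ext => z /=; rewrite scaler0. Qed.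
Lemma rank1_0r x : rank1 x 0 = bop0.
Proof. by apply: bop_ext => z /=; rewrite dot0r scale0r. Qed.
Lemma rank1Zr b x y : rank1 x (b *: y) = rank1 (b^* *: x) y.
Proof. by apply: bop_ext => z /=; rewrite dotZr !scalerA mulrC. Qed.

Lemma rank1_neq0 x y : x != 0 -> y != 0 -> rank1 x y <> bop0.
Proof.
move=> x0 y0 /(congr1 (fun A : bop H => A y)) /= /eqP.
by rewrite scaler_eq0 dotxx_eq0 (negbTE x0) (negbTE y0).
Qed.

Lemma rank1_rank_one x y : x != 0 -> y != 0 -> rank_one (rank1 x y).
Proof.
move=> x0 y0; exists x => //; apply/seteqP; split=> z /=.
  by move=> [w _ <-]; exists (dot w y).
move=> [a _ <-]; exists ((a / dot y y) *: y) => //=.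
by rewrite dotZl divfK// dotxx_eq0.
Qed.

Lemma bop_neq0 (A : bop H) : A <> bop0 -> exists z, A z != 0.
Proof.
move=> A0; apply: contrapT => /forallNP h; apply: A0; apply: bop_ext => z /=.
by have := h z => /negP; rewrite negbK => /eqP.
Qed.

(** The scalar by which [A z] is a multiple of [v] is a bounded functional of
    [z], so the Riesz theorem applies. *)
Lemma line_range_rank1 (A : bop H) v : A <> bop0 -> (forall z, exists a, A z = a *: v) ->
  exists x y, [/\ x != 0, y != 0 & A = rank1 x y].
Proof.
move=> A0 Av; have [z0 Az0] := bop_neq0 A0.
have v0 : v != 0.
  by apply: contraNneq Az0 => v0; have [a ->] := Av z0; rewrite v0 scaler0.
pose f z := dot (A z) v / dot v v.
have fE z : A z = f z *: v.
  by have [a e] := Av z; rewrite e /f e dotZl mulfK// dotxx_eq0.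
have [K K0 AK] := bop_bounded_ge0 A.
have [y yP] : exists y, forall z, f z = dot z y.
  apply: (@riesz _ _ _ dotP f (Re K / Num.sqrt (sq v))).
    by move=> a x y; rewrite /f linearP dotDl dotZl mulrDl mulrA.
  move=> z; have := AK z; rewrite !(normE dotP) fE.
  have -> : K = (Re K)%:C by rewrite RRe_real// ger0_real.
  have Kr : 0 <= Re K by rewrite -ler0c RRe_real// ger0_real.
  rewrite -rmorphM lecR sqZ => h.
  have : Num.sqrt (abs2 (f z) * sq v) ^+ 2 <= (Re K * Num.sqrt (sq z)) ^+ 2.
    by rewrite ler_pXn2r// nnegrE ?sqrtr_ge0// mulr_ge0// sqrtr_ge0.
  rewrite exprMn !sqr_sqrtr ?mulr_ge0 ?abs2_ge0 ?sq_ge0// => h2.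
  rewrite exprMn exprVn sqr_sqrtr ?sq_ge0// mulrAC ler_pdivlMr ?sq_gt0//.
have AE : A = rank1 v y by apply: bop_ext => z; rewrite /= fE yP.
exists v, y; split=> //; apply: contra_notN A0 => /eqP y0.
by rewrite AE y0 rank1_0r.
Qed.

(** Take for [B] the rank-one operator [y (x) y], with [y] the component of
    [v] orthogonal to [u]. *)
Lemma operators_separate_lines (u v : H) : u != 0 ->
  (forall B : bop H, B u = 0 -> B v = 0) -> exists a, v = a *: u.
Proof.
move=> u0 h; pose a := dot v u / dot u u; exists a.
pose y := v - a *: u.
have yu : dot y u = 0 by rewrite /y dotBl dotZl divfK ?subrr// dotxx_eq0.
apply/eqP; rewrite -subr_eq0 -/y -(dotxx_eq0 dot).
have /= := h (rank1 y y); rewrite (dot_eq0C yu) scale0r => /(_ erefl) /eqP.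
rewrite scaler_eq0 => /orP[/eqP vy|/eqP ->]; last by rewrite dot0l.
by rewrite {1}/y dotBl dotZl (dot_eq0C yu) mulr0 subr0 vy.
Qed.

Lemma orthogonal_line (u v : H) : u != 0 ->
  (forall w, w != 0 -> dot w u = 0 -> dot w v = 0) -> exists a, v = a *: u.
Proof.
move=> u0 h; exists (dot v u / dot u u); apply/eqP; rewrite -subr_eq0.
set y := v - _; have yu : dot y u = 0 by rewrite dotBl dotZl divfK ?subrr// dotxx_eq0.
apply/negPn/negP => y0; have := y0; rewrite -(dotxx_eq0 dot).
by rewrite {2}/y dotBr dotZr (h _ y0 yu) yu mulr0 subrr eqxx.
Qed.

Section NumericalRangeRankOne.
Variables (k : nat) (c : k.-tuple R).

Lemma c_rangeP A z : c_numerical_range dot c A z <->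
  exists2 e : 'I_k -> H, frame dot e & z = \sum_(i < k) (c`_i)%:C * dot (A (e i)) (e i).
Proof.
split=> -[e fe ->].
  exists (tnth e); first exact: frame_tnth.
  by apply: eq_bigr => i _; rewrite (tnth_nth 0).
exists [tuple e i | i < k]; first exact: frame_orthonormal.
by apply: eq_bigr => i _; rewrite (tnth_nth 0) !tnth_mktuple.
Qed.

Lemma c_range_rank1 x y :
  c_numerical_range dot c (rank1 x y) = pair_range dot k (nth 0 c) x y.
Proof.
by apply/seteqP; split=> z => [/c_rangeP[e fe ->]|[e fe ->]]; [|apply/c_rangeP];
  exists e => //; apply: eq_bigr => i _; rewrite /= dotZl.
Qed.
End NumericalRangeRankOne.
End RankOne.

(** * The action of the preserver on operators of rank one *)

Section Preservers.
Context {R : realType} {H : completeNormedModType R[i]}.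
Variable dot : {dot H for (@Num.conj R[i])}.
Hypothesis dotP : dot_induces_norm dot.
Local Notation sq := (sqnorm dot).
Local Notation rank1 := (rank1 dotP).
Variables (k : nat) (c : k.-tuple R) (Phi : bop H -> bop H).
Hypothesis k_gt1 : (1 < k)%N.
Hypothesis k_frame : has_frame dot k.
Hypothesis c_noninc : forall i j, (i <= j < k)%N -> c`_j <= c`_i.
Hypothesis c_lt : c`_k.-1 < c`_0.
Hypothesis Phi_surj : forall B, exists A, Phi A = B.
Hypothesis Phi_zero : preserves_weak_zero_products_both_sides Phi.
Hypothesis Phi_range : forall A B, c_numerical_range dot c (bopM (Phi A) (Phi B)) =
  c_numerical_range dot c (bopM A B).

Lemma range_rank1_inj x y x' y' :
  c_numerical_range dot c (rank1 x y) = c_numerical_range dot c (rank1 x' y') ->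
  [/\ dot x y ^+ 2 = dot x' y' ^+ 2, sq x * sq y = sq x' * sq y' &
      c`_0 + c`_k.-1 != 0 -> dot x y = dot x' y'].
Proof.
rewrite !c_range_rank1; exact: (pair_range_inj k_gt1 k_frame c_noninc c_lt).
Qed.

(** [A T] has rank one for [T] of rank one, and the scalar products below are
    its trace and the product of norms that the range remembers. *)
Lemma Phi_product (A : bop H) x y p q : Phi (rank1 x y) = rank1 p q ->
  [/\ dot (A x) y ^+ 2 = dot (Phi A p) q ^+ 2,
      sq (A x) * sq y = sq (Phi A p) * sq q &
      c`_0 + c`_k.-1 != 0 -> dot (A x) y = dot (Phi A p) q].
Proof.
move=> e; apply: range_rank1_inj; rewrite -!(bopM_rank1 dotP) -e.
exact/esym/Phi_range.
Qed.

Lemma Phi_kills (A : bop H) x y p q : y != 0 -> q != 0 -> Phi (rank1 x y) = rank1 p q ->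
  A x = 0 <-> Phi A p = 0.
Proof.
move=> y0 q0 /Phi_product-/(_ A)[_ e _]; split=> h; move/eqP: e; rewrite h sq0 mul0r.
  by rewrite eq_sym mulf_eq0 !sq_eq0 (negbTE q0) orbF => /eqP.
by rewrite mulf_eq0 !sq_eq0 (negbTE y0) orbF => /eqP.
Qed.

Lemma Phi_eq0 A : Phi A = bop0 <-> A = bop0.
Proof.
have sq_neq0 z : z != 0 -> sq z != 0 by rewrite sq_eq0.
split=> A0.
  apply: bop_ext => x; have [->|x0] := eqVneq x 0; first by rewrite !linear0.
  have : c_numerical_range dot c (rank1 (A x) x) = c_numerical_range dot c (rank1 0 0).
    by rewrite -bopM_rank1 -Phi_range A0 rank1_0l; congr c_numerical_range; apply: bop_ext.
  move=> /range_rank1_inj[_ /eqP + _]; rewrite sq0 mul0r mulf_eq0 !sq_eq0 (negbTE x0) orbF.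
  by move=> /eqP.
rewrite A0; apply: bop_ext => x; have [->|x0] := eqVneq x 0; first by rewrite !linear0.
have [S SE] := Phi_surj (rank1 x x).
have : c_numerical_range dot c (rank1 (Phi bop0 x) x) = c_numerical_range dot c (rank1 0 0).
  by rewrite -bopM_rank1 -SE Phi_range rank1_0l; congr c_numerical_range; apply: bop_ext.
move=> /range_rank1_inj[_ /eqP + _]; rewrite sq0 mul0r mulf_eq0 !sq_eq0 (negbTE x0) orbF.
by move=> /eqP.
Qed.

(** Left annihilators detect ranges, and zero products are statements about
    left annihilators. *)
Lemma killed_line (S' : bop H) x : x != 0 ->
  (forall B' : bop H, B' x = 0 -> bopM B' S' = bop0) -> forall z, exists a, S' z = a *: x.
Proof.
move=> x0 h z; apply: (operators_separate_lines dotP x0) => B Bx.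
by have := congr1 (fun A : bop H => A z) (h B Bx).
Qed.

(** If [u] and [u'] are nonzero vectors of the range of [Phi T], the preimages
    of [u (x) u] and [u' (x) u'] are operators of rank one with the same range
    as [T].  Hence they have the same left annihilators, and so do
    [u (x) u] and [u' (x) u']. *)
Lemma Phi_rank1 x y : x != 0 -> y != 0 ->
  exists p q, [/\ p != 0, q != 0 & Phi (rank1 x y) = rank1 p q].
Proof.
have [Phi_fwd Phi_bwd] := Phi_zero.
move=> x0 y0; set T := rank1 x y.
have T1 : rank_one T by exact: rank1_rank_one.
have PT0 : Phi T <> bop0 by move=> /Phi_eq0; apply: rank1_neq0.
have [z0 z0P] := bop_neq0 PT0.
(* [B' x = 0] gives [B' T = 0], so [Phi B'] kills the range of [Phi T], in
   particular [u], and the converse zero product condition applies. *)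
have pre z : Phi T z != 0 -> exists S' y', [/\ y' != 0,
    S' = rank1 x y' & Phi S' = rank1 (Phi T z) (Phi T z)].
  move=> uz; set u := Phi T z in uz *; have [S' S'E] := Phi_surj (rank1 u u).
  have S'line : forall w, exists a, S' w = a *: x.
    apply: killed_line => // B' B'x; apply: (Phi_bwd (Phi B') (rank1 u u)) => //.
      exact: rank1_rank_one.
    have /Phi_fwd : bopM B' T = bop0 by rewrite bopM_rank1 B'x rank1_0l.
    move=> /(_ T1) h; rewrite bopM_rank1.
    have -> : Phi B' u = 0 by have := congr1 (fun A : bop H => A z) h.
    by rewrite rank1_0l.
  have S'0 : S' <> bop0 by move=> /Phi_eq0; rewrite S'E; apply: rank1_neq0.
  have [v [w [v0 w0 S'vw]]] := line_range_rank1 dotP S'0 S'line.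
  have [a va] := S'line w; exists S', ((a / dot w w)^* *: w).
  have aw : (a / dot w w) *: x = v.
    rewrite mulrC -scalerA -va S'vw /= scalerA mulVf ?scale1r// dotxx_eq0 //.
  split=> //; last first.
    by rewrite S'vw rank1Zr conjCK aw.
  rewrite scaler_eq0 negb_or w0 andbT conjC_eq0; apply: contraNneq v0 => e.
  by rewrite -aw e scale0r.
have [S1 [y1 [y10 S1E PS1]]] := pre _ z0P.
apply: (line_range_rank1 dotP (v := Phi T z0) PT0) => z.
have [->|zP] := eqVneq (Phi T z) 0; first by exists 0; rewrite scale0r.
apply: (operators_separate_lines dotP z0P) => B Bu.
have [B' B'E] := Phi_surj B; have [S2 [y2 [y20 S2E PS2]]] := pre _ zP.
have B'x : B' x = 0.
  by rewrite S1E in PS1; rewrite (Phi_kills _ y10 z0P PS1) B'E.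
rewrite S2E in PS2; move: B'x; rewrite (Phi_kills _ y20 zP PS2) B'E //.
Qed.

(** Choose [x] in the range of [S] and compare with [Phi (x (x) x)], which has
    rank one: the two have the same left annihilators. *)
Lemma Phi_rank1_preimage S u v : u != 0 -> v != 0 -> Phi S = rank1 u v ->
  exists x y, [/\ x != 0, y != 0 & S = rank1 x y].
Proof.
have [Phi_fwd Phi_bwd] := Phi_zero; move=> u0 v0 SE.
have S0 : S <> bop0 by move=> /Phi_eq0; rewrite SE; apply: rank1_neq0.
have [z0 z0P] := bop_neq0 S0.
set x := S z0 in z0P; pose T := rank1 x x.
have [p [q [p0 q0 PT]]] := Phi_rank1 z0P z0P.
have [a pa] : exists a, p = a *: u.
  apply: (operators_separate_lines dotP u0) => B Bu; have [B' B'E] := Phi_surj B.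
  rewrite -B'E -(Phi_kills _ z0P q0 PT).
  have := Phi_bwd B (rank1 u v) B' S (rank1_rank_one dotP u0 v0).
  rewrite bopM_rank1 Bu rank1_0l => /(_ erefl B'E SE) h.
  by have := congr1 (fun A : bop H => A z0) h.
have a0 : a != 0 by apply: contraNneq p0 => a0; rewrite pa a0 scale0r.
apply: (line_range_rank1 dotP S0 (v := x)); apply: killed_line => // B' B'x.
apply: (Phi_bwd (Phi B') (rank1 u v)) => //; first exact: rank1_rank_one.
rewrite bopM_rank1; move: B'x; rewrite (Phi_kills _ z0P q0 PT) pa linearZ /= => /eqP.
by rewrite scaler_eq0 (negbTE a0) => /eqP ->; rewrite rank1_0l.
Qed.

(** The two arguments have the same left annihilators. *)
Lemma Phi_rank1_left x y y' p q p' q' : x != 0 ->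
  [/\ y != 0, p != 0, q != 0 & Phi (rank1 x y) = rank1 p q] ->
  [/\ y' != 0, q' != 0 & Phi (rank1 x y') = rank1 p' q'] -> exists a, p' = a *: p.
Proof.
move=> x0 [y0 p0 q0 e] [y0' q0' e'].
apply: (operators_separate_lines dotP p0) => B; have [B' <-] := Phi_surj B.
by rewrite -(Phi_kills B' y0 q0 e) (Phi_kills B' y0' q0' e').
Qed.

(** The two arguments kill the same operators of rank one from the left. *)
Lemma Phi_rank1_right x x' y p q p' q' :
  [/\ x != 0, q != 0 & Phi (rank1 x y) = rank1 p q] ->
  [/\ p' != 0 & Phi (rank1 x' y) = rank1 p' q'] -> exists a, q' = a *: q.
Proof.
move=> [x0 q0 e] [p0' e']; apply: (@orthogonal_line _ _ dot _ _ q0) => w w0 wq.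
have [S SE] := Phi_surj (rank1 w w).
have [z [t [z0 t0 SE']]] := Phi_rank1_preimage w0 w0 SE; rewrite SE' in SE.
have /= h := Phi_kills (rank1 x y) t0 w0 SE; have /= h' := Phi_kills (rank1 x' y) t0 w0 SE.
move: h h'; rewrite e e' /= wq scale0r => -[_ /(_ erefl)/eqP].
rewrite scaler_eq0 (negbTE x0) orbF => /eqP -> [+ _]; rewrite scale0r => /(_ erefl)/eqP.
by rewrite scaler_eq0 (negbTE p0') orbF => /eqP.
Qed.

Lemma Phi_rank1_right_preimage x x' y y' p p' q : y != 0 ->
  [/\ p != 0 & Phi (rank1 x y) = rank1 p q] ->
  [/\ x' != 0 & Phi (rank1 x' y') = rank1 p' q] -> exists a, y' = a *: y.
Proof.
move=> y0 [p0 e] [x0' e']; apply: (@orthogonal_line _ _ dot _ _ y0) => w w0 wy.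
have [s [t [s0 t0 se]]] := Phi_rank1 w0 w0.
have /= h := Phi_kills (rank1 x y) w0 t0 se; have /= h' := Phi_kills (rank1 x' y') w0 t0 se.
move: h h'; rewrite e e' /= wy scale0r => -[/(_ erefl)/eqP + _].
rewrite scaler_eq0 (negbTE p0) orbF => /eqP -> [_]; rewrite scale0r => /(_ erefl)/eqP.
by rewrite scaler_eq0 (negbTE x0') orbF => /eqP.
Qed.

Section BaseVector.
Variable e0 : H.
Hypothesis e0_unit : sq e0 = 1.

Let dot_e0 : dot e0 e0 = 1. Proof. by rewrite dotxx e0_unit. Qed.
Let e0_neq0 : e0 != 0. Proof. by rewrite -(sq_eq0 dot) e0_unit oner_eq0. Qed.

(** Squaring the projection gives [<p, u>^4 = 1] and [|p| = |<p, u>|] for the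
    image [p (x) u] with [u] a unit vector; equality in the Cauchy-Schwarz
    inequality puts [p] in the line of [u]. *)
Lemma Phi_projection : exists (a : R[i]) u0, [/\ abs2 a = 1, sq u0 = 1 &
  Phi (rank1 e0 e0) = rank1 (a *: u0) u0].
Proof.
have [p [q [p0 q0 e]]] := Phi_rank1 e0_neq0 e0_neq0.
have [s [s0 s1]] := unit_exists dot q0.
pose u := s *: q; pose p' := (s^-1)^* *: p; pose a := dot p' u.
have {}e : Phi (rank1 e0 e0) = rank1 p' u.
  by rewrite e -rank1Zr /u scalerA mulVf// scale1r.
have [] := Phi_product (rank1 e0 e0) e.
rewrite e /= !dot_e0 scale1r dot_e0 e0_unit s1 !mulr1 expr1n dotZl -/a sqZ => h1 h2 _.
have a1 : abs2 a = 1.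
  have /abs2_sqr : 1 ^+ 2 = (a ^+ 2) ^+ 2 :> R[i].
    by rewrite expr1n h1 -expr2.
  rewrite expr2 abs2M /abs2 /= expr1n expr0n addr0 -expr2 => /esym/eqP.
  rewrite -/(abs2 a) sqrf_eq1 => /orP[/eqP//|/eqP aN].
  by have := abs2_ge0 a; rewrite aN oppr_ge0 ler10.
exists a, u; split=> //; congr rank1.
rewrite a1 mul1r in h2.
by have := @cauchy_schwarz_eq _ _ dot p' u; rewrite -/a a1 -h2 s1 mulr1 scale1r; apply.
Qed.

(** [f] and [h] describe the images of [x (x) e0] and of [e0 (x) y]; their
    product is the image of a product, whence [<f x, h y>^2 = <x, y>^2].
    Equality in the Cauchy-Schwarz inequality for [y = x] shows [h = +- f]. *)
Lemma Phi_implemented : exists U : H -> H, [/\ linear U,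
  forall x, sq (U x) = sq x, forall y, exists x, U x = y &
  forall x y, x != 0 -> y != 0 -> exists a, Phi (rank1 x y) = rank1 (a *: U x) (U y)].
Proof.
have [a [u0 [a1 u1 Pe0]]] := Phi_projection.
have u0_neq0 : u0 != 0 by rewrite -(sq_eq0 dot) u1 oner_eq0.
have a0 : a != 0 by rewrite -abs2_eq0 a1 oner_eq0.
have au0 : a *: u0 != 0 by rewrite scaler_eq0 negb_or a0.
have dot_u0 : dot u0 u0 = 1 by rewrite dotxx u1.
have /choice[f fP] : forall x, exists p, Phi (rank1 x e0) = rank1 p u0.
  move=> x; have [->|x0] := eqVneq x 0.
    by exists 0; rewrite !rank1_0l; apply/Phi_eq0.
  have [p [q [p0 q0 e]]] := Phi_rank1 x0 e0_neq0.
  have [b qb] := @Phi_rank1_right e0 x e0 _ u0 p q (And3 e0_neq0 u0_neq0 Pe0) (conj p0 e).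
  by exists (b^* *: p); rewrite e qb rank1Zr.
have /choice[h hP] : forall y, exists q, Phi (rank1 e0 y) = rank1 u0 q.
  move=> y; have [->|y0] := eqVneq y 0.
    by exists 0; rewrite !rank1_0r; apply/Phi_eq0.
  have [p [q [p0 q0 e]]] := Phi_rank1 e0_neq0 y0.
  have [b pb] := @Phi_rank1_left e0 e0 y _ u0 p q e0_neq0 (And4 e0_neq0 au0 u0_neq0 Pe0) (And3 y0 q0 e).
  by exists ((b * a)^* *: q); rewrite e pb rank1Zr conjCK scalerA.
have fh x y : dot (f x) (h y) ^+ 2 = dot x y ^+ 2 /\ sq (f x) * sq (h y) = sq x * sq y.
  have [] := Phi_product (rank1 x e0) (hP y).
  by rewrite fP /= dot_e0 dot_u0 !scale1r => -> -> _.
have f_e0 : sq (f e0) = 1.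
  have := congr1 (fun A : bop H => A u0) (fP e0).
  by rewrite Pe0 /= dot_u0 !scale1r => <-; rewrite sqZ a1 u1 mulr1.
have sq_h y : sq (h y) = sq y by have [_] := fh e0 y; rewrite f_e0 e0_unit !mul1r.
have sq_f x : sq (f x) = sq x.
  by have [_] := fh x e0; rewrite sq_h e0_unit !mulr1.
have hf x : h x = f x \/ h x = - f x.
  have [->|x0] := eqVneq x 0.
    have /eqP := sq_h 0; have /eqP := sq_f 0; rewrite sq0 !sq_eq0 => /eqP -> /eqP ->.
    by left.
  have [/eqP + _] := fh x x; rewrite eqf_sqr => fhx.
  have sx0 : (sq x)%:C != 0 by rewrite -dotxx dotxx_eq0.
  have /cauchy_schwarz_eq : abs2 (dot (f x) (h x)) = sq (f x) * sq (h x).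
    rewrite sq_f sq_h; have [/abs2_sqr -> _] := fh x x.
    by rewrite dotxx abs2_realC expr2.
  rewrite sq_h; case/orP: fhx => /eqP ->; rewrite dotxx ?scaleNr => e.
    by left; apply: (scalerI sx0).
  by right; apply: (scalerI sx0); rewrite scalerN e opprK.
have ff x y : dot (f x) (f y) ^+ 2 = dot x y ^+ 2.
  by have [<- _] := fh x y; have [->|->] := hf y; rewrite ?dotNr ?sqrrN.
have f_surj w : exists x, f x = w.
  have [->|w0] := eqVneq w 0.
    by exists 0; apply/eqP; rewrite -(sq_eq0 dot) sq_f sq0.
  have [S SE] := Phi_surj (rank1 w u0).
  have [z [y [z0 y0 SE']]] := Phi_rank1_preimage w0 u0_neq0 SE; rewrite SE' in SE.
  have [b yb] := @Phi_rank1_right_preimage e0 z e0 y _ w u0 e0_neq0 (conj au0 Pe0) (conj z0 SE).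
  exists (b^* *: z); have := congr1 (fun A : bop H => A u0) (fP (b^* *: z)).
  by rewrite -rank1Zr -yb SE /= dot_u0 !scale1r.
have [U Ul fU] := signed_isometry f_surj ff dot_e0.
have UN x : U (- x) = - U x.
  have UD y z : U (y + z) = U y + U z by rewrite -[y]scale1r Ul !scale1r.
  have U0 : U 0 = 0 by have := UD 0 0; rewrite addr0 -{1}[U 0]addr0 => /addrI.
  by rewrite -scaleN1r -[_ *: x]addr0 Ul U0 addr0 scaleN1r.
exists U; split=> //.
- by move=> x; rewrite -(sq_f x); have [->|->] := fU x; rewrite ?sqN.
- move=> w; have [x <-] := f_surj w; have [->|->] := fU x; first by exists x.
  by exists (- x).
move=> x y x0 y0; have [p [q [p0 q0 e]]] := Phi_rank1 x0 y0.
have fx0 : f x != 0 by rewrite -(sq_eq0 dot) sq_f sq_eq0.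
have hy0 : h y != 0 by rewrite -(sq_eq0 dot) sq_h sq_eq0.
have [b pb] := @Phi_rank1_left x e0 y _ u0 p q x0 (And4 e0_neq0 fx0 u0_neq0 (fP x)) (And3 y0 q0 e).
have [d qd] := @Phi_rank1_right e0 x y _ (h y) p q (And3 e0_neq0 hy0 (hP y)) (conj p0 e).
rewrite e pb qd rank1Zr scalerA.
have [s fs] : exists s, f x = s *: U x.
  by have [->|->] := fU x; [exists 1; rewrite scale1r|exists (-1); rewrite scaleN1r].
have [t ht] : exists t, h y = t *: U y.
  have [->|->] := hf y; have [->|->] := fU y; rewrite ?opprK;
    first [by exists 1; rewrite scale1r|by exists (-1); rewrite scaleN1r].
by exists (t^* * (d^* * b * s)); rewrite fs ht rank1Zr !scalerA !mulrA.
Qed.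
End BaseVector.
End Preservers.

(** * Unitary implementation up to a fourth root of unity *)

Section UnitaryForm.
Context {R : realType} {H : completeNormedModType R[i]}.
Variable dot : {dot H for (@Num.conj R[i])}.
Hypothesis dotP : dot_induces_norm dot.
Local Notation sq := (sqnorm dot).
Local Notation rank1 := (rank1 dotP).

Lemma isometry_bounded (U : H -> H) : (forall x, sq (U x) = sq x) ->
  exists M : R, forall x, `|U x| <= M%:C * `|x|.
Proof. by move=> Us; exists 1 => x; rewrite mul1r !(normE dotP) Us. Qed.

(** The adjoint is the inverse, so that its existence is explicit here. *)
Lemma unitary_of_isometry (U : H -> H) : linear U ->
  (forall x, sq (U x) = sq x) -> (forall y, exists x, U x = y) ->
  exists U' V : bop H, [/\ U' =1 U, adjoint dot U' = V, cancel U' V & cancel V U'].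
Proof.
move=> Ul Us Usurj; have Udot := isometry_dot Ul Us.
have /choice[V UV] := Usurj.
have Ub := isometry_bounded Us; pose U' := BOp Ul Ub.
have UI : injective U.
  move=> x y Uxy; apply/eqP; rewrite -subr_eq0 -(sq_eq0 dot) -Us.
  by rewrite [U _](linearB U') /= Uxy subrr sq0.
have Vl : linear V by move=> a x y; apply: UI; rewrite Ul !UV.
have Vb := @isometry_bounded V (fun x => etrans (esym (Us _)) (congr1 sq (UV x))).
exists U', (BOp Vl Vb); split=> //.
  by apply: adjointE => x y /=; rewrite -[RHS]Udot UV.
by move=> x; apply: UI; rewrite /= UV.
Qed.

Variables (k : nat) (c : k.-tuple R) (Phi : bop H -> bop H).
Hypothesis k_gt1 : (1 < k)%N.
Hypothesis k_frame : has_frame dot k.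
Hypothesis c_noninc : forall i j, (i <= j < k)%N -> c`_j <= c`_i.
Hypothesis c_lt : c`_k.-1 < c`_0.
Hypothesis Phi_surj : forall B, exists A, Phi A = B.
Hypothesis Phi_zero : preserves_weak_zero_products_both_sides Phi.
Hypothesis Phi_range : forall A B, c_numerical_range dot c (bopM (Phi A) (Phi B)) =
  c_numerical_range dot c (bopM A B).

Let Phi_prod := Phi_product (dotP := dotP) k_gt1 k_frame c_noninc c_lt Phi_range.

(** In [Phi (x (x) y) = a (U x (x) U y)] the square of [a] does not depend on
    [x] and [y], by comparison with a common [z (x) w] that is orthogonal to
    neither.  If [kap] is this constant, then
    [kap <Phi A U x, U y>^2 = <A x, y>^2], and two uses of the fact that a
    space is not a union of two proper subspaces remove the dependence of the
    sign on [y] and then on [x]. *)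
Lemma Phi_unitary_form : exists (U : bop H) (eta : R[i]) (g : bop H -> R[i]),
  [/\ unitary dot U, eta = 1 \/ eta = 'i, forall A, is_sign (g A) &
      forall A, Phi A = bopZ (eta * g A) (conj_by dot U A)].
Proof.
have [e0 e01] : exists e0, sq e0 = 1.
  have [e fe] := k_frame; exists (e (Ordinal (ltnW k_gt1))).
  by rewrite /sqnorm fe eqxx.
have e00 : e0 != 0 by rewrite -(sq_eq0 dot) e01 oner_eq0.
have [U0 [U0l U0s U0surj U0P]] := Phi_implemented dotP k_gt1 k_frame c_noninc c_lt
  Phi_surj Phi_zero Phi_range e01.
have [U [V [UE adjU UK VK]]] := unitary_of_isometry U0l U0s U0surj.
have {U0s U0surj}Udot x y : dot (U x) (U y) = dot x y.
  by rewrite !UE; apply: isometry_dot.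
have {}U0P x y : x != 0 -> y != 0 -> exists a, Phi (rank1 x y) = rank1 (a *: U x) (U y).
  by move=> x0 y0; have [a ->] := U0P x y x0 y0; exists a; rewrite !UE.
have mul2 x y a z w b : Phi (rank1 x y) = rank1 (a *: U x) (U y) ->
    Phi (rank1 z w) = rank1 (b *: U z) (U w) ->
    dot x w != 0 -> dot z y != 0 -> a ^+ 2 * b ^+ 2 = 1.
  move=> ea eb xw zy; have [+ _ _] := Phi_prod (rank1 z w) ea.
  rewrite eb /= !dotZl !Udot => e.
  have h : (dot x w * dot z y) ^+ 2 != 0 by rewrite expf_neq0// mulf_neq0.
  by apply: (mulIf h); rewrite mul1r [RHS]e; ring.
have [a0 a0P] := U0P _ _ e00 e00.
pose kap := a0 ^+ 2.
have kap2 : kap ^+ 2 = 1.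
  by rewrite expr2; apply: (mul2 _ _ _ _ _ _ a0P a0P); rewrite dotxx_eq0.
have akap x y a : x != 0 -> y != 0 -> Phi (rank1 x y) = rank1 (a *: U x) (U y) ->
    a ^+ 2 = kap.
  move=> x0 y0 ea.
  have [z [yz ez]] := nonorthogonal2 dot y0 e00.
  have [w [xw ew]] := nonorthogonal2 dot x0 e00.
  have zy : dot z y != 0 by rewrite dotC conjC_eq0.
  have ze : dot z e0 != 0 by rewrite dotC conjC_eq0.
  have z0 : z != 0 by apply: contraNneq zy => ->; rewrite dot0l.
  have w0 : w != 0 by apply: contraNneq xw => ->; rewrite dot0r.
  have [b bP] := U0P _ _ z0 w0.
  have h1 := mul2 _ _ _ _ _ _ ea bP xw zy.
  have h2 := mul2 _ _ _ _ _ _ a0P bP ew ze.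
  have b0 : b ^+ 2 != 0 by apply/negP => /eqP b0; move/eqP: h1; rewrite b0 mulr0 eq_sym oner_eq0.
  by apply: (mulIf b0); rewrite h1 /kap h2.
have [eta [eta1 eta2]] : exists eta : R[i], (eta = 1 \/ eta = 'i) /\ eta ^+ 2 = kap.
  have /eqP := kap2; rewrite sqrf_eq1 => /orP[]/eqP ->.
    by exists 1; split; [left|rewrite expr1n].
  by exists 'i; split; [right|rewrite sqrCi].
have /choice[g gP] : forall A, exists s, is_sign s /\ Phi A = bopZ (eta * s) (conj_by dot U A).
  move=> A; pose A' := bopZ eta (bopM V (bopM (Phi A) U)).
  have A'P x y : dot (A' x) y ^+ 2 = dot (A x) y ^+ 2.
    have [->|x0] := eqVneq x 0; first by rewrite !linear0.
    have [->|y0] := eqVneq y 0; first by rewrite !dot0r.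
    have [a aP] := U0P _ _ x0 y0.
    have [-> _ _] := Phi_prod A aP.
    rewrite /= linearZ /= !dotZl !exprMn (akap _ _ _ x0 y0 aP) eta2.
    by rewrite -[dot (V _) y]Udot VK.
  have eta4 : eta * kap * eta = 1 by rewrite mulrAC -expr2 eta2 -expr2 kap2.
  have fin s : (forall x, A' x = s *: A x) -> Phi A = bopZ (eta * (kap * s)) (conj_by dot U A).
    move=> h; apply: bop_ext => z; rewrite /= adjU.
    have := congr1 U (h (V z)); rewrite /= !linearZ /= !VK => e.
    by rewrite mulrA -scalerA -e scalerA eta4 scale1r.
  have sgn_kap s : is_sign s -> is_sign (kap * s).
    rewrite /is_sign; have /eqP := kap2; rewrite sqrf_eq1 => /orP[]/eqP ->.
      by rewrite mul1r.
    by rewrite mulN1r => -[->|->]; rewrite ?opprK; [right|left].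
  have [h|h] := @linear_pm _ _ (bop_fun A' : {linear H -> H}) (bop_fun A : {linear H -> H})
    (fun x => eq_dot_sqr (A'P x)).
    exists (kap * 1); split; first by apply: sgn_kap; left.
    by apply: fin => x; rewrite scale1r; apply: h.
  exists (kap * -1); split; first by apply: sgn_kap; right.
  by apply: fin => x; rewrite scaleN1r; apply: h.
exists U, eta, g; split=> //.
- by split; rewrite adjU; apply: bop_ext => x /=.
- by move=> A; have [] := gP A.
- by move=> A; have [] := gP A.
Qed.
End UnitaryForm.

(** * Extreme values of the range of a projection *)

Section Projection.
Context {R : realType} {H : completeNormedModType R[i]}.
Variable dot : {dot H for (@Num.conj R[i])}.
Hypothesis dotP : dot_induces_norm dot.
Local Notation sq := (sqnorm dot).
Local Notation frame := (frame dot).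
Variables (k : nat) (g : 'I_k -> H).
Hypothesis g_frame : frame g.

(** The squared norm of the projection of [v] on the span of the first [q + 1]
    vectors of [g]. *)
Definition mass (q : nat) (v : H) : R := \sum_(i < k | (i <= q)%N) abs2 (dot v (g i)).

Lemma mass_ge0 q v : 0 <= mass q v.
Proof. by apply: sumr_ge0 => i _; apply: abs2_ge0. Qed.

Lemma mass_le q v : mass q v <= sq v.
Proof.
apply: le_trans (bessel v g_frame); rewrite [leRHS](bigID (fun i : 'I_k => (i <= q)%N)) /=.
by rewrite lerDl sumr_ge0// => i _; apply: abs2_ge0.
Qed.

Lemma mass_frame q (j : 'I_k) : mass q (g j) = (j <= q)%N%:R.
Proof.
have E i : abs2 (dot (g j) (g i)) = (i == j)%:R.
  by rewrite g_frame eq_sym; case: eqP => _; rewrite /abs2 /= ?expr1n expr0n addr0.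
rewrite /mass big_mkcond /= (bigD1 j)//= E eqxx big1 ?addr0; first by case: leqP.
by move=> i /negbTE ij; rewrite E ij; case: ifP.
Qed.

Lemma total_mass q (e : 'I_k -> H) : (q < k)%N -> frame e ->
  \sum_j mass q (e j) <= q.+1%:R.
Proof.
move=> qk fe; rewrite exchange_big /=.
have le1 (i : 'I_k) : \sum_j abs2 (dot (e j) (g i)) <= 1.
  have := bessel (g i) fe; rewrite /sqnorm g_frame eqxx /=.
  by under eq_bigr do rewrite dotC abs2J.
apply: le_trans (ler_sum _ (fun i _ => le1 i)) _.
have -> : \sum_(i < k | (i <= q)%N) (1 : R) = \sum_(i < q.+1) 1.
  by rewrite [RHS](big_ord_widen k (fun=> 1)).
by rewrite sumr_const card_ord.
Qed.

(** The masses of a family lie in [0, 1] and have sum at most [q + 1], so that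
    the least conceivable value of the sum is obtained by putting mass 1 on the
    [q] last indices, where [c] takes the values [- c_0, ..., - c_(q-1)], and
    the remaining unit where it costs [ga].  This stays above the opposite of
    the value at [g] because [- c_q < ga]. *)
Lemma extreme_mass_lt (c : nat -> R) (q : nat) (e : 'I_k -> H) : frame e ->
  (q <= k.-1 - q)%N -> (q < k)%N ->
  (forall i j, (i <= j < k)%N -> c j <= c i) ->
  (forall j, (j < q)%N -> c j + c (k.-1 - j)%N = 0) ->
  0 < c q + c (k.-1 - q)%N ->
  - \sum_(j < k) c j * mass q (g j) < \sum_(j < k) c j * mass q (e j).
Proof.
move=> fe q2 qk c_noninc c_anti c_pos.
have cq0 : 0 < c q.
  have : c (k.-1 - q)%N <= c q by apply: c_noninc; lia.
  by move: c_pos; lra.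
(* The vectors [g i] need not lie in the span of [e], so the total mass may
   fall short of [q + 1]: whence the minimum with 0. *)
pose ga : R := Num.min (c (k.-1 - q)%N) 0.
have ga0 : ga <= 0 by rewrite ge_min lexx orbT.
have ga1 : ga <= c (k.-1 - q)%N by rewrite ge_min lexx.
have gaq : - c q < ga by rewrite lt_min; apply/andP; split; move: c_pos cq0; lra.
have -> : \sum_(j < k) c j * mass q (g j) = \sum_(j < q.+1) c j.
  rewrite (big_ord_widen k (fun j => c j))// [RHS]big_mkcond /=.
  by apply: eq_bigr => j _; rewrite mass_frame ltnS; case: leqP; rewrite ?mulr1 ?mulr0.
have -> : \sum_(j < k) c j * mass q (e j) =
    \sum_(j < k) (c j - ga) * mass q (e j) + ga * \sum_(j < k) mass q (e j).
  by rewrite mulr_sumr -big_split /=; apply: eq_bigr => j _; ring.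
have h1 : ga * q.+1%:R <= ga * \sum_(j < k) mass q (e j).
  by rewrite ler_wnM2l// total_mass.
have h2 : \sum_(j < q) (c (k.-1 - j)%N - ga) <= \sum_(j < k) (c j - ga) * mass q (e j).
  rewrite (big_ord_widen k (fun j => c (k.-1 - j)%N - ga)) 1?ltnW// big_mkcond /=.
  rewrite (reindex_inj rev_ord_inj) /=; apply: ler_sum => j _.
  have jk := ltn_ord j.
  have -> : (k.-1 - (k - j.+1) = j)%N by lia.
  have m0 := mass_ge0 q (e j).
  have m1 : mass q (e j) <= 1.
    by apply: le_trans (mass_le _ _) _; rewrite /sqnorm fe eqxx.
  case: ifP => jq.
    have cj : c j <= ga.
      rewrite le_min; apply/andP; split; first by apply: c_noninc; lia.
      have kj : (k.-1 - j < q)%N by lia.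
      have := c_anti _ kj; have -> : (k.-1 - (k.-1 - j) = j)%N by lia.
      have : c q <= c (k.-1 - j)%N by apply: c_noninc; lia.
      by move: cq0; lra.
    nra.
  apply: mulr_ge0 => //; rewrite subr_ge0; apply: le_trans ga1 _.
  by apply: c_noninc; lia.
have h3 : \sum_(j < q) (c (k.-1 - j)%N - ga) = - \sum_(j < q) c j - ga * q%:R.
  rewrite sumrB sumr_const card_ord -sumrN mulr_natr; congr (_ - _).
  by apply: eq_bigr => j _; have := c_anti _ (ltn_ord j); lra.
rewrite big_ord_recr /=; move: h1 h2; rewrite h3 -natr1; lra.
Qed.

Fact projection_linear q : linear (fun v => \sum_(i < k | (i <= q)%N) dot v (g i) *: g i).
Proof.
move=> a x y; rewrite scaler_sumr -big_split /=; apply: eq_bigr => i _.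
by rewrite dotDl dotZl scalerDl scalerA.
Qed.

Lemma projection_sq q v : sq (\sum_(i < k | (i <= q)%N) dot v (g i) *: g i) = mass q v.
Proof.
rewrite big_mkcond /=.
under eq_bigr => i _ do rewrite -[X in if _ then _ else X](scale0r (g i)) -(fun_if (fun a => a *: g i)).
rewrite sq_frame// /mass [RHS]big_mkcond /=; apply: eq_bigr => i _.
by case: ifP => // _; rewrite /abs2 /= expr0n addr0.
Qed.

Fact projection_bounded q : exists M : R, forall v,
  `|\sum_(i < k | (i <= q)%N) dot v (g i) *: g i| <= M%:C * `|v|.
Proof.
exists 1 => v; rewrite mul1r !(normE dotP) lecR ler_sqrt ?sq_ge0//.
by rewrite projection_sq mass_le.
Qed.

Definition projection q : bop H := BOp (projection_linear q) (projection_bounded q).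

Lemma dot_projection q v : dot (projection q v) v = (mass q v)%:C.
Proof.
rewrite /= dot_suml /mass rmorph_sum /=; apply: eq_bigr => i _.
by rewrite dotZl (dotC dot (g i)) abs2E.
Qed.

Lemma projection_idem q : bopM (projection q) (projection q) = projection q.
Proof.
apply: bop_ext => v /=; apply: eq_bigr => j jq; congr (_ *: _).
rewrite big_mkcond /=.
under eq_bigr => i _ do rewrite -[X in if _ then _ else X](scale0r (g i)) -(fun_if (fun a => a *: g i)).
by rewrite dot_frame// jq.
Qed.
End Projection.

(** * The three forms preserve ranges of products *)

Section Ranges.
Context {R : realType} {H : completeNormedModType R[i]}.
Variable dot : {dot H for (@Num.conj R[i])}.
Hypothesis dotP : dot_induces_norm dot.
Local Notation sq := (sqnorm dot).
Local Notation frame := (frame dot).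
Variables (k : nat) (c : k.-tuple R).
Local Notation W := (c_numerical_range dot c).

Lemma c_rangeN A : W (bopZ (-1) A) = [set - z | z in W A].
Proof.
have E e : \sum_(i < k) (c`_i)%:C * dot (bopZ (-1) A (e i)) (e i) =
   - \sum_(i < k) (c`_i)%:C * dot (A (e i)) (e i).
  by rewrite -sumrN; apply: eq_bigr => i _; rewrite /= dotZl mulN1r mulrN.
apply/seteqP; split=> z.
  move=> /c_rangeP[e fe ->]; rewrite E.
  by exists (\sum_(i < k) (c`_i)%:C * dot (A (e i)) (e i)) => //; apply/c_rangeP; exists e.
by move=> [_ /c_rangeP[e fe ->] <-]; apply/c_rangeP; exists e.
Qed.

Lemma bopZ1 (A : bop H) : bopZ 1 A = A.
Proof. by apply: bop_ext => x /=; rewrite scale1r. Qed.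

(** The purpose of [sgn_set]: these signs are invisible to the range. *)
Lemma c_range_sgn s A : sgn_set dot c A s -> W (bopZ s A) = W A.
Proof. by move=> [->|[-> symA]]; rewrite ?bopZ1// c_rangeN -symA. Qed.

(** Reversing the orthonormal family changes the sign of the value. *)
Lemma antisymmetric_range A : (forall j, (j < k)%N -> c`_j + c`_(k.-1 - j) = 0) ->
  symmetric_range dot c A.
Proof.
move=> c_anti; have rev (e : 'I_k -> H) : frame e ->
    frame (e \o @rev_ord k) /\
    \sum_(i < k) (c`_i)%:C * dot (A (e (rev_ord i))) (e (rev_ord i)) =
    - \sum_(i < k) (c`_i)%:C * dot (A (e i)) (e i).
  move=> fe; split=> [i j|]; first by rewrite /= fe (inj_eq rev_ord_inj).
  rewrite (reindex_inj rev_ord_inj) /= -sumrN; apply: eq_bigr => i _.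
  rewrite rev_ordK -mulNr; congr (_ * _).
  have := c_anti i (ltn_ord i); have -> : (k.-1 - i = k - i.+1)%N by lia.
  by rewrite -rmorphN => /eqP; rewrite addr_eq0 eq_sym eqr_oppLR => /eqP <-.
rewrite /symmetric_range; apply/seteqP; split=> z.
  move=> /c_rangeP[e fe ->]; have [fr er] := rev e fe.
  exists (- \sum_(i < k) (c`_i)%:C * dot (A (e i)) (e i)); last by rewrite opprK.
  by apply/c_rangeP; exists (e \o @rev_ord k); rewrite // -er.
move=> [_ /c_rangeP[e fe ->] <-]; have [fr er] := rev e fe.
by apply/c_rangeP; exists (e \o @rev_ord k); rewrite // -er.
Qed.

Hypothesis k_gt0 : (0 < k)%N.
Hypothesis k_frame : has_frame dot k.

Lemma unit_vector : exists e0, sq e0 = 1.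
Proof.
have [e fe] := k_frame; exists (e (Ordinal k_gt0)).
by rewrite /sqnorm fe eqxx.
Qed.

(** If [U] had no adjoint, [adjoint U] would be the default value 0, which is not
    a left inverse of [U] on a nonzero space. *)
Lemma unitary_adjoint (U : bop H) : unitary dot U -> is_adjoint dot U (adjoint dot U).
Proof.
move=> [UV _]; rewrite /adjoint.
have [ex|nex] := pselect (exists B, is_adjoint dot U B); first exact: xgetPex.
have [e0 e01] := unit_vector; move: UV; rewrite /adjoint xgetPN.
  move=> /(congr1 (fun A : bop H => A e0)) /= e.
  by move/eqP: e01; rewrite -e sq0 eq_sym oner_eq0.
by move=> B UB; apply: nex; exists B.
Qed.

Section Conjugation.
Variable U : bop H.
Hypothesis U_unitary : unitary dot U.
Local Notation V := (adjoint dot U).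

Let VK x : V (U x) = x.
Proof. by have [e _] := U_unitary; exact: (congr1 (fun A : bop H => A x) e). Qed.
Let UK x : U (V x) = x.
Proof. by have [_ e] := U_unitary; exact: (congr1 (fun A : bop H => A x) e). Qed.

Lemma unitary_dot x y : dot (U x) (U y) = dot x y.
Proof. by rewrite (unitary_adjoint U_unitary) VK. Qed.

Lemma c_range_conj A : W (conj_by dot U A) = W A.
Proof.
apply/seteqP; split=> z /c_rangeP[e fe ->]; apply/c_rangeP.
  exists (fun i => V (e i)); first by move=> i j; rewrite -unitary_dot !UK.
  by apply: eq_bigr => i _; rewrite /= (unitary_adjoint U_unitary).
exists (fun i => U (e i)); first by move=> i j; rewrite unitary_dot.
by apply: eq_bigr => i _; rewrite /= VK unitary_dot.
Qed.

Lemma conj_bopM a b A B :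
  bopM (bopZ a (conj_by dot U A)) (bopZ b (conj_by dot U B)) =
  conj_by dot U (bopZ (a * b) (bopM A B)).
Proof. by apply: bop_ext => x /=; rewrite !linearZ /= VK scalerA mulrC. Qed.

Lemma c_range_conjM a b A B : sgn_set dot c (bopM A B) (a * b) ->
  W (bopM (bopZ a (conj_by dot U A)) (bopZ b (conj_by dot U B))) = W (bopM A B).
Proof. by move=> ab; rewrite conj_bopM c_range_conj c_range_sgn. Qed.

Lemma conj_rank1 a x y : bopZ a (conj_by dot U (rank1 dotP x y)) =
  rank1 dotP (a *: U x) (U y).
Proof.
apply: bop_ext => z /=; rewrite linearZ /= scalerA mulrC -scalerA; congr (_ *: _).
by rewrite -[in LHS](VK y) -unitary_dot !UK.
Qed.
End Conjugation.

Lemma sign_mul (s t : R[i]) : is_sign s -> is_sign t -> is_sign (s * t).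
Proof.
by move=> [->|->] [->|->]; rewrite ?mul1r ?mulN1r ?opprK; [left|right|right|left].
Qed.

Lemma sign_sqr (s : R[i]) : is_sign s -> s * s = 1.
Proof. by move=> [->|->]; rewrite ?mul1r ?mulN1r ?opprK. Qed.

Lemma sign_mul_eq1 (s t : R[i]) : is_sign t -> s * t = 1 -> s = t.
Proof.
by move=> st h; rewrite -[s]mulr1 -(sign_sqr st) mulrA h mul1r.
Qed.

Variable Phi : bop H -> bop H.

Lemma form_i_range : form_i dot Phi ->
  forall A B, W (bopM (Phi A) (Phi B)) = W (bopM A B).
Proof.
move=> [U [eps [Uu se PhiE]]] A B; rewrite !PhiE c_range_conjM//.
by left; apply: sign_sqr.
Qed.

Lemma form_ii_range : form_ii dot c Phi ->
  forall A B, W (bopM (Phi A) (Phi B)) = W (bopM A B).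
Proof.
move=> [U [phi [phi' [eps [Uu phiS phi'S phi'P [_ epsE PhiT PhiS PhiN]]]]]] A B.
have Phi_sign X : exists s, [/\ is_sign s, Phi X = bopZ s (conj_by dot U X) &
    symmetric_core dot c X \/ s = phi' X].
  have [TX|nTX] := pselect (symmetric_core dot c X).
    by exists (phi X); split; [exact: phiS|exact: PhiT|left].
  have [SX|nSX] := pselect (symmetric_range dot c X).
    by exists (phi' X); split; [exact: phi'S|exact: PhiS|right].
  by exists (phi' X); split; [exact: phi'S|rewrite (epsE _ nSX); exact: PhiN|right].
have [a [sa -> ca]] := Phi_sign A; have [b [sb -> cb]] := Phi_sign B.
apply: c_range_conjM => //.
case: ca => [[_ TA]|->].
  by have [] := sign_mul sa sb; [left|right; split=> //; case: (TA B)].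
case: cb => [[_ TB]|->]; last exact: phi'P.
by have [] := sign_mul (phi'S A) sb; [left|right; split=> //; case: (TB A)].
Qed.

Lemma form_iii_range : (forall A, symmetric_range dot c A) -> form_iii dot Phi ->
  forall A B, W (bopM (Phi A) (Phi B)) = W (bopM A B).
Proof.
move=> sym [U [g [Uu gS [PhiE|PhiE]]]] A B; rewrite !PhiE; apply: c_range_conjM => //.
  by have [] := sign_mul (gS A) (gS B); [left|right].
rewrite mulrACA -expr2 sqrCi mulN1r.
by have [] := sign_mul (gS A) (gS B) => ->; rewrite ?opprK; [right|left].
Qed.
End Ranges.

(** * From the unitary implementation to the three forms *)

Section Forward.
Context {R : realType} {H : completeNormedModType R[i]}.
Variable dot : {dot H for (@Num.conj R[i])}.
Hypothesis dotP : dot_induces_norm dot.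
Local Notation rank1 := (rank1 dotP).
Variables (k : nat) (c : k.-tuple R) (Phi : bop H -> bop H).
Hypothesis k_gt1 : (1 < k)%N.
Hypothesis k_frame : has_frame dot k.
Hypothesis c_noninc : forall i j, (i <= j < k)%N -> c`_j <= c`_i.
Hypothesis c_lt : c`_k.-1 < c`_0.
Local Notation W := (c_numerical_range dot c).
Hypothesis Phi_range : forall A B, W (bopM (Phi A) (Phi B)) = W (bopM A B).
Variables (U : bop H) (eta : R[i]) (g : bop H -> R[i]).
Hypothesis U_unitary : unitary dot U.
Hypothesis g_sign : forall A, is_sign (g A).
Hypothesis PhiE : forall A, Phi A = bopZ (eta * g A) (conj_by dot U A).

Let k_gt0 : (0 < k)%N := ltnW k_gt1.

(** Here traces of products with operators of rank one are preserved, not only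
    their squares: [eta^2 g A g T = 1] as soon as [A T] has nonzero trace.
    A nonzero [A] and the identity have a common such [T]. *)
Lemma form_i_of_range : c`_0 + c`_k.-1 != 0 -> eta = 1 \/ eta = 'i -> form_i dot Phi.
Proof.
move=> c_sum eta1.
have key (A : bop H) x y : dot (A x) y != 0 -> eta ^+ 2 * (g A * g (rank1 x y)) = 1.
  move=> Axy; have := PhiE (rank1 x y); rewrite (conj_rank1 dotP k_gt0 k_frame U_unitary).
  move=> /(Phi_product k_gt1 k_frame c_noninc c_lt Phi_range A)[_ _ /(_ c_sum)].
  rewrite PhiE /= !linearZ /= !dotZl (unitary_dot k_gt0 k_frame U_unitary).
  have [e _] := U_unitary; have -> : adjoint dot U (U x) = x.
    exact: (congr1 (fun A : bop H => A x) e).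
  by move=> h; apply: (mulIf Axy); rewrite mul1r [RHS]h; ring.
have [e0 e01] := unit_vector k_gt0 k_frame.
have e00 : dot e0 e0 = 1 by rewrite dotxx e01.
have eta2 : eta ^+ 2 = 1.
  have := key (rank1 e0 e0) e0 e0; rewrite /= e00 scale1r e00 oner_eq0 sign_sqr// mulr1.
  by apply.
have {}eta1 : eta = 1.
  case: eta1 => // ei; move/eqP: eta2; rewrite ei sqrCi eq_sym -subr_eq0 opprK.
  by rewrite -mulr2n pnatr_eq0.
exists U, (g bop1); split=> // A; rewrite PhiE eta1 mul1r.
have [->|/eqP A0] := eqVneq A bop0.
  by apply: bop_ext => x /=; rewrite !linear0 ?scaler0.
congr bopZ.
have [x Ax] := bop_neq0 A0.
have x0 : x != 0 by apply: contraNneq Ax => ->; rewrite linear0.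
have [y [Axy xy]] := nonorthogonal2 dot Ax x0.
have := key A x y Axy; have := key bop1 x y xy; rewrite eta2 !mul1r.
by do 2 move/(sign_mul_eq1 (g_sign _)) => ->.
Qed.

Lemma form_ii_of_range : eta = 1 -> form_ii dot c Phi.
Proof.
move=> eta1; have gP A B : sgn_set dot c (bopM A B) (g A * g B).
  case: (sign_mul (g_sign A) (g_sign B)) => e; first by left.
  right; split=> //; rewrite /symmetric_range -c_rangeN -Phi_range !PhiE.
  by rewrite (conj_bopM U_unitary) (c_range_conj _ k_gt0 k_frame U_unitary) eta1 !mul1r e.
exists U, g, g, (g bop1); split=> //; split=> //.
- move=> A nSA; have := gP A bop1; have -> : bopM A bop1 = A by apply: bop_ext.
  move=> [h|[_ /nSA//]].
  exact: (sign_mul_eq1 (g_sign _)).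
- by move=> A _; rewrite PhiE eta1 mul1r.
- by move=> A _ _; rewrite PhiE eta1 mul1r.
- move=> A nSA; rewrite PhiE eta1 mul1r; congr bopZ.
  have := gP A bop1; have -> : bopM A bop1 = A by apply: bop_ext.
  move=> [h|[_ /nSA//]].
  exact: (sign_mul_eq1 (g_sign _)).
Qed.

Lemma form_iii_of_range : eta = 1 \/ eta = 'i -> form_iii dot Phi.
Proof.
move=> eta1; exists U, g; split=> //; case: eta1 => e; [left|right] => A.
  by rewrite PhiE e mul1r.
by rewrite PhiE e.
Qed.

Lemma symmetric_square A : eta = 'i -> symmetric_range dot c (bopM A A).
Proof.
move=> ei; rewrite /symmetric_range -c_rangeN -Phi_range !PhiE.
rewrite (conj_bopM U_unitary) (c_range_conj _ k_gt0 k_frame U_unitary).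
by rewrite ei mulrACA (sign_sqr (g_sign A)) -expr2 sqrCi mulr1.
Qed.
End Forward.

(** * A projection with asymmetric range *)

Section Asymmetry.
Context {R : realType} {H : completeNormedModType R[i]}.
Variable dot : {dot H for (@Num.conj R[i])}.
Hypothesis dotP : dot_induces_norm dot.
Variables (k : nat) (c : k.-tuple R).
Hypothesis k_frame : has_frame dot k.
Hypothesis c_noninc : forall i j, (i <= j < k)%N -> c`_j <= c`_i.

(** If [c_q + c_(k-1-q)] is positive, the opposite of the value at [g] is below
    all values.  The other sign reduces to this one by reversing the families
    and replacing [c] by its reversed opposite. *)
Lemma asymmetric_projection q : (q <= k.-1 - q)%N -> (q < k)%N ->
  (forall j, (j < q)%N -> c`_j + c`_(k.-1 - j) = 0) ->
  c`_q + c`_(k.-1 - q) != 0 ->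
  exists2 P : bop H, bopM P P = P & ~ symmetric_range dot c P.
Proof.
move=> q2 qk c_anti c_q; have [g fg] := k_frame.
exists (projection dotP fg q); first exact: projection_idem.
move=> symP.
have flip (e : 'I_k -> H) : frame dot e -> exists2 e', frame dot e' &
    \sum_(j < k) c`_j * mass dot g q (e' j) = - \sum_(j < k) c`_j * mass dot g q (e j).
  move=> fe; pose z (e : 'I_k -> H) :=
    \sum_(j < k) (c`_j)%:C * dot (projection dotP fg q (e j)) (e j).
  have zE e' : z e' = (\sum_(j < k) c`_j * mass dot g q (e' j))%:C.
    by rewrite /z rmorph_sum /=; apply: eq_bigr => j _; rewrite (dot_projection dotP fg) rmorphM.
  have : c_numerical_range dot c (projection dotP fg q) (- z e).
    by rewrite symP; exists (z e) => //; apply/c_rangeP; exists e.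
  move=> /c_rangeP[e' fe']; rewrite -/(z e') !zE -rmorphN => /complexI h.
  by exists e'.
have [c_pos|c_neg|c0] := ltrgtP 0 (c`_q + c`_(k.-1 - q)); last by rewrite -c0 eqxx in c_q.
- have [e' fe' e'E] := flip g fg.
  have := extreme_mass_lt fg fe' q2 qk c_noninc c_anti c_pos.
  by rewrite e'E ltxx.
pose c' j := - c`_(k.-1 - j).
have rev_sum (e : 'I_k -> H) : \sum_(j < k) c' j * mass dot g q (e j) =
    - \sum_(j < k) c`_j * mass dot g q (e (rev_ord j)).
  rewrite (reindex_inj rev_ord_inj) -sumrN /=; apply: eq_bigr => j _.
  rewrite /c'; have -> : (k.-1 - (k - j.+1) = j)%N by have := ltn_ord j; lia.
  by rewrite mulNr.
have frev (e : 'I_k -> H) : frame dot e -> frame dot (e \o @rev_ord k).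
  by move=> fe i j; rewrite /= fe (inj_eq rev_ord_inj).
have [e' fe' e'E] := flip _ (frev _ fg).
have /(_ c') := @extreme_mass_lt _ _ dot k g fg _ q (e' \o @rev_ord k) (frev _ fe') q2 qk.
have revK : \sum_(j < k) c`_j * mass dot g q (e' (rev_ord (rev_ord j))) =
    \sum_(j < k) c`_j * mass dot g q (e' j).
  by apply: eq_bigr => j _; rewrite rev_ordK.
rewrite !rev_sum /= revK e'E /= ltxx => absurd; apply: notF; apply: absurd.
- by move=> i j ij; rewrite /c' lerN2; apply: c_noninc; lia.
- move=> j jq; rewrite /c'; have -> : (k.-1 - (k.-1 - j) = j)%N by lia.
  by have := c_anti j jq; lra.
- rewrite /c'; have -> : (k.-1 - (k.-1 - q) = q)%N by lia.
  by move: c_neg; lra.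
Qed.
End Asymmetry.

Theorem theorem1p2 (R : realType) (H : completeNormedModType R[i])
    (dot : {dot H for (@Num.conj R[i])}) (k : nat) (c : k.-tuple R)
    (Phi : bop H -> bop H)
    (dotP : dot_induces_norm dot)
    (dim_ge2 : hilbert_dim_ge dot 2)
    (k_ge2 : (2 <= k)%N) (k_le_dim : hilbert_dim_ge dot k)
    (c_noninc : sorted >=%R c) (c_nonconst : ~~ constant c)
    (Phi_surj : forall B, exists A, Phi A = B)
    (Phi_zero : preserves_weak_zero_products_both_sides Phi) :
  (forall A B, c_numerical_range dot c (bopM (Phi A) (Phi B)) =
               c_numerical_range dot c (bopM A B)) <->
  [\/ pair_sum c 1 != 0 /\ form_i dot Phi,
      (exists p, [/\ (1 < p < k)%N, pair_sum c p != 0 &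
                     forall j, (1 <= j < p)%N -> pair_sum c j = 0]) /\
      form_ii dot c Phi |
      (forall j, (1 <= j <= k)%N -> pair_sum c j = 0) /\ form_iii dot Phi].
Proof.
have k_gt0 : (0 < k)%N by exact: ltnW.
have k_frame := hilbert_dim_frame k_le_dim.
have c_le i j : (i <= j < k)%N -> c`_j <= c`_i.
  move=> /andP[ij jk]; have := sorted_leq_nth (rev_trans le_trans) (@lexx _ _) 0 c_noninc.
  by apply=> //; rewrite inE size_tuple// (leq_ltn_trans ij).
have c_lt : c`_k.-1 < c`_0.
  rewrite lt_neqAle c_le ?andbT; last by lia.
  apply: contraNN c_nonconst => /eqP ce; apply: (@all_pred1_constant _ c`_0); apply/all_pred1P.
  apply: (@eq_from_nth _ 0); rewrite ?size_nseq// size_tuple => i ik.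
  rewrite nth_nseq ik; apply/eqP; rewrite eq_le -{2}ce !c_le //; lia.
split=> [Phi_range|[[_ fi]|[_ fii]|[sym fiii]]]; last first.
- apply: (form_iii_range k_gt0 k_frame) fiii => A; apply: antisymmetric_range => j jk.
  have := sym j.+1; rewrite /pair_sum /=; have -> : (k - j.+1 = k.-1 - j)%N by lia.
  by apply; lia.
- exact: (form_ii_range k_gt0 k_frame).
- exact: (form_i_range c k_gt0 k_frame).
have [U [eta [g [Uu eta1 gS PhiE]]]] :=
  Phi_unitary_form dotP k_ge2 k_frame c_le c_lt Phi_surj Phi_zero Phi_range.
have ps1 : pair_sum c 1 = c`_0 + c`_k.-1 by rewrite /pair_sum subn1.
have psE j : (j < k)%N -> pair_sum c j.+1 = c`_j + c`_(k.-1 - j).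
  by move=> jk; rewrite /pair_sum /=; congr (_ + c`_ _); lia.
have [p1|p1] := eqVneq (pair_sum c 1) 0; last first.
  apply: Or31; split=> //.
  by apply: (form_i_of_range dotP k_ge2 k_frame c_le c_lt Phi_range Uu gS PhiE); rewrite -?ps1.
have [all0|] := pselect (forall j, (1 <= j <= k)%N -> pair_sum c j = 0).
  by apply: Or33; split=> //; apply: form_iii_of_range PhiE eta1.
move=> /existsNP ex.
have {}ex : exists j, (0 < j <= k)%N && (pair_sum c j != 0).
  have [j /not_implyP[jk /eqP pj]] := ex.
  by exists j; rewrite jk.
case: (ex_minnP ex) => p /andP[/andP[p_gt0 p_lek] p_neq] p_min.
have p_lt j : (1 <= j < p)%N -> pair_sum c j = 0.
  move=> /andP[j1 jp]; apply/eqP; apply: contraT => j_neq.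
  have jk : (j <= k)%N by apply: ltnW; apply: leq_trans p_lek.
  by have := p_min j; rewrite j1 j_neq jk leqNgt jp => /(_ isT).
have ps_sym j : (0 < j <= k)%N -> pair_sum c (k.+1 - j) = pair_sum c j.
  by move=> jk; rewrite /pair_sum addrC; congr (c`_ _ + c`_ _); lia.
have p_half : (p <= k.+1 - p)%N.
  by apply: p_min; rewrite ps_sym ?p_gt0// p_neq andbT; lia.
have p_gt1 : (1 < p)%N.
  by rewrite ltn_neqAle p_gt0 andbT; apply: contraNneq p_neq => <-; rewrite p1.
apply: Or32; split; first by exists p; split=> //; lia.
apply: (form_ii_of_range k_ge2 k_frame Phi_range Uu gS PhiE).
case: eta1 => // eta_i.
have [||||P PP asym] := @asymmetric_projection _ _ _ dotP _ c k_frame c_le p.-1.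
- by lia.
- by lia.
- by move=> j jp; rewrite -psE; [apply: p_lt|]; lia.
- by rewrite -psE; [rewrite prednK|lia].
by case: asym; rewrite -PP; apply: (symmetric_square k_ge2 k_frame Phi_range Uu gS PhiE).
Qed.
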